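(* Consider the cancel-on-completion (c.o.c.) variant of the fork-join$(n_{\mathrm F},n_{\mathrm J})$ model on $N$ servers with the FCFS discipline, in steady state, where $1\le n_{\mathrm J}\le n_{\mathrm F}\le N$, and assume $\rho_{\mathrm U}:=\mathbb{E}[B_{(n_{\mathrm J})}]/\mathbb{E}[A]<1$. Then: (i) if $B_{(n_{\mathrm J})}\in RV(-\tilde\nu)$, then $W_{(n_{\mathrm J})}\in ORV(1-\tilde\nu)$; (ii) if $B_{(n_{\mathrm J})}\in RV(-\tilde\nu)$, then $R\in ORV(1-\tilde\nu)$.
   Context: Model. There are $N$ parallel unit-speed servers, each serving in first-come first-served (FCFS) order. Jobs arrive at the epochs of a renewal process with i.i.d. interarrival times distributed as $A$, with finite mean. On arrival of a job, replicas of it are assigned to $n_{\mathrm F}$ distinct servers chosen uniformly at random. The replica sizes $(B_1,\dots,B_{n_{\mathrm F}})$ of a job have some joint distribution, with each $B_i$ distributed as $B$ but not necessarily independent of each other; the vectors for different jobs are i.i.d. and independent of arrivals and server choices. In the c.o.c. variant, as soon as $n_{\mathrm J}$ of the $n_{\mathrm F}$ replicas of a job have finished service, its remaining replicas are abandoned and the job is completed. For random variables $X_1,\dots,X_n$, $X_{(j)}$ denotes the $j$-th order statistic ($j$-th smallest). $W_1,\dots,W_{n_{\mathrm F}}$ are the steady-state waiting times of the replicas of a job at its $n_{\mathrm F}$ servers (the time until the replica's service starts if it is still in the system then); $W_{(n_{\mathrm J})}$ and $B_{(n_{\mathrm J})}$ are the $n_{\mathrm J}$-th order statistics of the $W_i$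 and of the $B_i$. The steady-state response time is $R=(W+B)_{(n_{\mathrm J})}$, the $n_{\mathrm J}$-th order statistic of $W_1+B_1,\dots,W_{n_{\mathrm F}}+B_{n_{\mathrm F}}$. $X\in RV(-\nu)$ means $\mathbb{P}(X>x)=L(x)x^{-\nu}$ for $x>0$, where $L$ is slowly varying: $L(\alpha x)/L(x)\to1$ as $x\to\infty$ for every $\alpha>0$. $X\in ORV(-\nu)$ means that there are positive constants $c_1,c_2$ such that, with $\bar F(x)=\mathbb{P}(X>x)$, for all $\alpha\ge1$, $$c_1\alpha^{-\nu}<\liminf_{x\to\infty}\frac{\bar F(\alpha x)}{\bar F(x)}\le\limsup_{x\to\infty}\frac{\bar F(\alpha x)}{\bar F(x)}<c_2\alpha^{-\nu}.$$ *)

(* Defs.v *)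
From HB Require Import structures.
From mathcomp Require Import all_boot all_order all_algebra finmap.
From mathcomp Require Import all_classical all_reals all_analysis.

Set Implicit Arguments.
Unset Strict Implicit.
Unset Printing Implicit Defensive.

Import Order.TTheory GRing.Theory Num.Theory.
Import numFieldNormedType.Exports.

Local Open Scope classical_set_scope.
Local Open Scope ring_scope.

(* [j] counts from 1: [ordstat 1 t] is the smallest entry of [t]. *)
Definition ordstat (R : realType) (n j : nat) (t : n.-tuple R) : R :=
  nth 0 (sort <=%R t) j.-1.

Definition tail d (T : measurableType d) (R : realType) (P : probability T R)
    (X : T -> R) (x : R) : R :=
  fine (P [set w | x < X w]).

Definition slowly_varying (R : realType) (L : R -> R) : Prop :=
  forall a : R, 0 < a -> L (a * x) / L x @[x --> +oo] --> (1 : R).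

(* The index carries its sign: [regularly_varying P X (- nu)] is "X in RV(-nu)". *)
Definition regularly_varying d (T : measurableType d) (R : realType) (P : probability T R)
    (X : T -> R) (r : R) : Prop :=
  exists2 L : R -> R, slowly_varying L &
    forall x : R, 0 < x -> tail P X x = L x * x `^ r.

(* Same sign convention as [regularly_varying]. Where the tail vanishes the ratio is the
   junk value 0, which the strict positive lower bound on the liminf rules
   out for large x. *)
Definition O_regularly_varying d (T : measurableType d) (R : realType) (P : probability T R)
    (X : T -> R) (r : R) : Prop :=
  exists c1 c2 : R, [/\ 0 < c1, 0 < c2 & forall a : R, 1 <= a ->
    let ratio (x : R) := (tail P X (a * x) / tail P X x)%:E in
    ((c1 * a `^ r)%:E < limf_einf ratio +oo%R)%E /\
    (limf_esup ratio +oo%R < (c2 * a `^ r)%:E)%E].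

Definition same_law d d' (T : measurableType d) (T' : measurableType d')
    (R : realType) (P : probability T R) (X Y : T -> T') : Prop :=
  forall C : set T', measurable C -> P (X @^-1` C) = P (Y @^-1` C).

Definition mutually_independent d (T : measurableType d) (R : realType)
    (P : probability T R) (I : choiceType) (F : I -> set_system T) : Prop :=
  forall (J : {fset I}) (E : I -> set T), (forall i, i \in J -> F i (E i)) ->
    P (\bigcap_(i in [set` J]) E i) = (\prod_(i <- J) P (E i))%E.

Variant source :=
  Initial | Interarrival of nat | Sizes of nat | Servers of nat.

Definition source_code (i : source) : unit + (nat + (nat + nat)) :=
  match i with
  | Initial => inl tt
  | Interarrival n => inr (inl n)
  | Sizes n => inr (inr (inl n))
  | Servers n => inr (inr (inr n))
  end.

Definition source_decode (c : unit + (nat + (nat + nat))) : source :=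
  match c with
  | inl _ => Initial
  | inr (inl n) => Interarrival n
  | inr (inr (inl n)) => Sizes n
  | inr (inr (inr n)) => Servers n
  end.

Lemma source_codeK : cancel source_code source_decode.
Proof. by case. Qed.

HB.instance Definition _ := Choice.copy source (can_type source_codeK).

Section Dynamics.
Context {R : realType} {N nF : nat} (nJ : nat).

(* An arriving job sees workloads [v] (time until each server has cleared the
   replicas already assigned to it), has replica sizes [b], and sends replica
   [i] to server [s i]. Under FCFS later arrivals do not affect it. *)
Implicit Types (v : N.-tuple R) (s : {ffun 'I_nF -> 'I_N}) (b : nF.-tuple R).

Definition waits v s : nF.-tuple R := [tuple tnth v (s i) | i < nF].

(* Completion of the nJ-th replica in the absence of cancellation; since
   cancellation happens only at that instant, this is the response time. *)
Definition response v s b : R :=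
  ordstat nJ [tuple tnth (waits v s) i + tnth b i | i < nF].

(* Replica [i] leaves at the earlier of the end of its service and the
   completion of the job. If the job completes before the replica reaches
   service, the replica is removed from the queue and the workload of its
   server is unchanged, hence the maximum with [tnth v k]. For injective [s]
   the big maximum has at most one term besides [tnth v k]. *)
Definition workload_after v s b : N.-tuple R :=
  [tuple \big[Num.max/tnth v k]_(i < nF | s i == k)
     Num.min (tnth (waits v s) i + tnth b i) (response v s b) | k < N].

Definition next_workload v s b (a : R) : N.-tuple R :=
  [tuple Num.max 0 (tnth (workload_after v s b) k - a) | k < N].

End Dynamics.

Section Model.
Context d (T : measurableType d) (R : realType) (P : probability T R).
Context (N nF nJ : nat).
(* [A n] is the time between the arrivals of jobs [n] and [n.+1]; [V0] is the
   workload vector found by job 0. *)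
Context (A : nat -> {RV P >-> R}) (B : nat -> {RV P >-> nF.-tuple R}).
Context (S : nat -> T -> {ffun 'I_nF -> 'I_N}) (V0 : {RV P >-> N.-tuple R}).

Fixpoint workload (n : nat) (w : T) : N.-tuple R :=
  if n is m.+1 then next_workload nJ (workload m w) (S m w) (B m w) (A m w)
  else V0 w.

Definition source_events (i : source) : set_system T :=
  match i with
  | Initial => preimage_set_system setT V0 measurable
  | Interarrival n => preimage_set_system setT (A n) measurable
  | Sizes n => preimage_set_system setT (B n) measurable
  | Servers n => preimage_set_system setT (S n) setT
  end.

Record coc_model : Prop := CocModel {
  coc_A_ge0 : forall n w, 0 <= A n w;
  coc_A_law : forall n, same_law P (A n) (A 0%N);
  coc_A_mean : (0 < 'E_P[A 0%N] < +oo)%E;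
  coc_B_ge0 : forall n i w, 0 <= tnth (B n w) i;
  coc_B_law : forall n, same_law P (B n) (B 0%N);
  coc_B_marginals : forall i j,
    same_law P (fun w => tnth (B 0%N w) i) (fun w => tnth (B 0%N w) j);
  coc_S_meas : forall n f, measurable (S n @^-1` [set f]);
  coc_S_inj : forall n w, injective (S n w);
  coc_S_unif : forall n (f : {ffun 'I_nF -> 'I_N}), injective f ->
    P (S n @^-1` [set f]) = ((N ^_ nF)%:R^-1)%:E;
  coc_V0_ge0 : forall k w, 0 <= tnth (V0 w) k;
  coc_indep : mutually_independent P source_events }.

(* Workloads found at arrival epochs form a Markov chain; the chain is
   started from an invariant law. *)
Definition steady_state : Prop :=
  forall n, same_law P (workload n) V0.

Definition wait_stat (n : nat) (w : T) : R :=
  ordstat nJ (waits (workload n w) (S n w)).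

Definition response_time (n : nat) (w : T) : R :=
  response nJ (workload n w) (S n w) (B n w).

Definition size_stat (n : nat) (w : T) : R := ordstat nJ (B n w).

Definition rho_U : \bar R := ('E_P[size_stat 0] / 'E_P[A 0%N])%E.

End Model.

(* Main.v *)
From HB Require Import structures.
Require Import Defs.
From mathcomp Require Import all_boot all_order all_algebra finmap.
From mathcomp Require Import all_classical all_reals all_analysis.
From mathcomp Require Import measurable_realfun ring lra.

Import Order.TTheory GRing.Theory Num.Theory.
Import numFieldNormedType.Exports.
Set Implicit Arguments.
Unset Strict Implicit.
Unset Printing Implicit Defensive.
Local Open Scope classical_set_scope.
Local Open Scope ring_scope.

(** Write [X] for the [nJ]-th smallest replica size of a job, [F] for its tail
    and [G x = E (X - x)^+], the integral of [F] over [[x, +oo[]. Both the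
    [nJ]-th waiting time and the response time turn out to have tails of the
    exact order of [G]. If [F] is regularly varying of index [r], then scaling
    the argument by [a] multiplies [G] asymptotically by [a * a `^ r], so every
    tail that lies between two multiples of [G] is O-regularly varying of index
    [1 + r] ([o_regvar_sandwich]). The reference is [G] rather than [x F x],
    because [G] is of larger order than [x F x] when [r = -1].

    Upper bound. A job that finds peak workload [m] is completed within
    [m + X], and no server works on it afterwards; hence the peak workload is
    dominated by the waiting time of a single-server queue with service times
    [X] ([peak_next]), which is stable because its load is [rho_U]. In the
    stationary regime the tail [t] of the peak therefore satisfies
    [t x <= E t (x - X + A)] for [x >= 0], and the interarrival time may even
    be capped at a constant without losing stability. The function
    [min 1 (C G)] satisfies the reverse inequality when [C] is large: over
    services shorter than [e x] the argument of [G] moves up on average, and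
    the resulting decrease of [G], of order [F x], pays for the services longer
    than [e x], whose probability is of the same order. Comparing the two
    ([queue_tail_le]) gives [t <= C G]. The response time is at most peak
    workload plus [X], which changes the constant only.

    Lower bound. Fix one set of [nF] servers, and let [H] be the [nJ]-th
    smallest workload on it. Between arrivals [H] drops by at most [A], and a
    job sent to this very set raises it to at least [X], because [nF - nJ + 1]
    replicas are no smaller than [X] and are served until the job is completed
    ([waits_next_ge_size]). So the stationary tail [h] of [H] satisfies
    [h x >= E h (x + A) + q F (x + K)] for some [q > 0], whereas small
    multiples of [G] satisfy the reverse inequality; thus [h >= c G]
    ([excess_le_tail]). The tagged job uses the fixed set with positive
    probability.

    Both comparisons are instances of one maximum principle
    ([maximum_principle]), and use stationarity over a single step only. *)

(** * Order statistics *)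

Section OrderStatistics.
Context {R : realType} {n : nat}.
Implicit Types (t u : n.-tuple R) (x y : R) (j : nat).

(** Sorting is replaced by counting, through which both the comparison and the
    measurability of order statistics go. *)
Lemma lt_ordstat j t x : (1 <= j <= n)%N ->
  (x < ordstat j t) = (count (fun y => (y <= x)%R) t < j)%N.
Proof.
move=> /andP[j1 jn].
have ss : sorted <=%R (sort <=%R t) by apply: sort_sorted; exact: le_total.
have -> : count (fun y => (y <= x)%R) t =
    count (fun y => (y <= x)%R) (sort <=%R t).
  by apply/permP; rewrite perm_sym perm_sort.
have sz : size (sort <=%R t) = n by rewrite size_sort size_tuple.
rewrite /ordstat; case: ltnP => c.
  by apply: nth_count_gt => //; rewrite -ltnS sz prednK// c/= jn.
apply/negbTE; rewrite -leNgt; apply: nth_count_le => //.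
by rewrite prednK.
Qed.

Lemma count_tupleE (p : pred R) t : count p t = (\sum_(i < n) p (tnth t i))%N.
Proof.
by rewrite -sumn_count -[in LHS](map_tnth_enum t) -map_comp sumnE big_map big_enum.
Qed.

Lemma ordstat_count j t : (1 <= j <= n)%N ->
  (j <= count (fun y => (y <= ordstat j t)%R) t)%N.
Proof. by move=> jn; rewrite leqNgt -lt_ordstat// ltxx. Qed.

(** Entries of [t] above its [j]-th order statistic may be cut down to it: this
    is what cancellation does to the work of the slower replicas. *)
Lemma ordstat_capped j t u c : (1 <= j <= n)%N ->
  (forall i, Num.min (tnth t i) (ordstat j t) <= tnth u i + c) ->
  ordstat j t <= ordstat j u + c.
Proof.
move=> jn tu; rewrite leNgt; apply/negP => lt.
suff: ordstat j u + c < ordstat j u + c by rewrite ltxx.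
have := lt; rewrite lt_ordstat// ltnNge; apply: contraNT => _.
apply: (leq_trans (ordstat_count u jn)).
rewrite !count_tupleE; apply: leq_sum => i _.
case: (leP (tnth u i)) => // ui.
have := le_trans (tu i) (lerD ui (lexx c)).
by rewrite ge_min (leNgt (ordstat j t)) lt orbF => ->.
Qed.

Lemma ordstat_shift j t u c : (1 <= j <= n)%N ->
  (forall i, tnth t i <= tnth u i + c) -> ordstat j t <= ordstat j u + c.
Proof.
move=> jn tu; apply: ordstat_capped => // i.
by rewrite ge_min tu.
Qed.

Lemma ordstat_le_ub j t c : (1 <= j <= n)%N ->
  (forall i, tnth t i <= c) -> ordstat j t <= c.
Proof.
move=> jn tc; rewrite leNgt lt_ordstat// -leqNgt count_tupleE.
rewrite (eq_bigr (fun=> 1%N)) => [|i _]; last by rewrite tc.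
by rewrite sum1_card card_ord; case/andP: jn.
Qed.

Lemma ordstat_ge_lb j t c : (1 <= j <= n)%N ->
  (forall i, c <= tnth t i) -> c <= ordstat j t.
Proof.
move=> jn tc; rewrite leNgt; apply/negP => lt.
suff: ordstat j t < ordstat j t by rewrite ltxx.
rewrite lt_ordstat// count_tupleE big1 ?(andP jn).1// => i _.
by case: leP => //; rewrite leNgt (lt_le_trans lt).
Qed.

End OrderStatistics.

(** * One step of the workload recursion *)

Section Recursion.
Context {R : realType} {N nF nJ : nat}.
Hypothesis nJF : (1 <= nJ <= nF)%N.
Implicit Types (v : N.-tuple R) (s : {ffun 'I_nF -> 'I_N}) (b : nF.-tuple R).
Implicit Types (a : R) (k : 'I_N) (i : 'I_nF).

Definition peak v : R := \big[Num.max/0]_(k < N) tnth v k.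

Lemma tnth_le_peak v k : tnth v k <= peak v.
Proof. exact: le_bigmax. Qed.

Lemma response_le_peak v s b : response nJ v s b <= peak v + ordstat nJ b.
Proof.
rewrite addrC; apply: ordstat_shift => // i.
by rewrite !tnth_mktuple addrC lerD2l tnth_le_peak.
Qed.

Lemma waits_le_response v s b : (forall i, 0 <= tnth b i) ->
  ordstat nJ (waits v s) <= response nJ v s b.
Proof.
move=> b0; rewrite -[leRHS]addr0; apply: ordstat_shift => // i.
by rewrite addr0 [leRHS]tnth_mktuple lerDl.
Qed.

Lemma size_le_response v s b : (forall k, 0 <= tnth v k) ->
  ordstat nJ b <= response nJ v s b.
Proof.
move=> v0; rewrite -[leRHS]addr0; apply: ordstat_shift => // i.
by rewrite addr0 [leRHS]tnth_mktuple lerDr tnth_mktuple.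
Qed.

Lemma workload_drain v s b a k :
  tnth v k - a <= tnth (next_workload nJ v s b a) k.
Proof.
rewrite tnth_mktuple le_max; apply/orP; right; rewrite lerD2r tnth_mktuple.
exact: bigmax_ge_id.
Qed.

(** Cancellation stops all work on a job at the response time, which exceeds
    the peak workload by at most the [nJ]-th smallest size: the peak is
    dominated by a single-server queue fed with the [nJ]-th smallest sizes. *)
Lemma peak_next v s b a : (forall i, 0 <= tnth b i) ->
  peak (next_workload nJ v s b a) <= Num.max 0 (peak v + ordstat nJ b - a).
Proof.
move=> b0; apply: bigmax_le => [|k _]; first by rewrite le_max lexx.
rewrite tnth_mktuple; apply: le_max2 => //; rewrite lerD2r tnth_mktuple.
apply: bigmax_le => [|i _].
  by rewrite (le_trans (tnth_le_peak v k))// lerDl ordstat_ge_lb.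
by rewrite (le_trans _ (response_le_peak v s b))// ge_min lexx orbT.
Qed.

(** At least [nF - nJ + 1] replicas of a job are no smaller than its [nJ]-th
    smallest size, and each keeps its server busy for that long. *)
Lemma waits_next_ge_size v s b a : (forall k, 0 <= tnth v k) ->
  ordstat nJ b <= ordstat nJ (waits (next_workload nJ v s b a) s) + a.
Proof.
move=> v0; apply: ordstat_capped => // i.
rewrite !tnth_mktuple -lerBlDr le_max; apply/orP; right; rewrite lerD2r.
rewrite (bigmaxD1 i)//= le_max le_min.
apply/orP; left; apply/andP; split.
  by rewrite ge_min tnth_mktuple lerDr v0.
by rewrite ge_min size_le_response ?orbT.
Qed.

Lemma waits_drain v s b a (s' : {ffun 'I_nF -> 'I_N}) :
  ordstat nJ (waits v s') <=
  ordstat nJ (waits (next_workload nJ v s b a) s') + a.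
Proof.
apply: ordstat_shift => // i.
by rewrite ![tnth (waits _ _) _]tnth_mktuple -lerBlDr workload_drain.
Qed.

End Recursion.

(** * Measurability of the model *)

Section Measurability.
Context {d d'} {T : measurableType d} {T' : measurableType d'} {R : realType}.

Lemma measurable_mktuple n (F : 'I_n -> T -> R) :
  (forall i, measurable_fun setT (F i)) ->
  measurable_fun setT (fun w => [tuple F i w | i < n]).
Proof.
move=> mF; apply/measurable_fun_tnthP => i.
rewrite (_ : _ \o _ = F i)//.
by apply/funext => w /=; rewrite tnth_mktuple.
Qed.

Lemma measurable_ordstat n j (f : T -> n.-tuple R) : (1 <= j <= n)%N ->
  measurable_fun setT f -> measurable_fun setT (fun w => ordstat j (f w)).
Proof.
move=> jn mf _; apply: (measurability _ (RGenOInfty.measurableE R)) => //.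
move=> _ [_ [x ->] <-]; rewrite setTI.
pose c w : R := \sum_(i < n) (if (tnth (f w) i <= x)%R then 1%R else 0%R).
have cE w : c w = (count (fun y => (y <= x)%R) (f w))%:R.
  by rewrite count_tupleE natr_sum; apply: eq_bigr => i _; case: ifP.
rewrite (_ : _ @^-1` _ = [set w | c w < j%:R]); last first.
  by apply/seteqP; split => w /=; rewrite in_itv/= andbT lt_ordstat// cE ltr_nat.
have mlt : measurable_fun setT (fun w => c w < j%:R).
  apply: measurable_fun_ltr => //; apply: measurable_sum => i.
  apply: measurable_fun_ifT => //; apply: measurable_fun_ler => //.
  exact: (measurable_fun_tnthP f).1.
by rewrite -[X in measurable X]setTI; exact: mlt measurableT [set true] _.

Qed.

Lemma measurable_bigmax (I : Type) (l : seq I) (p : pred I) (F : I -> T -> R)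
    (x0 : T -> R) : measurable_fun setT x0 ->
    (forall i, measurable_fun setT (F i)) ->
  measurable_fun setT (fun w => \big[Num.max/x0 w]_(i <- l | p i) F i w).
Proof.
move=> mx mF; elim: l => [|i l IH].
  by under eq_fun do rewrite big_nil.
under eq_fun do rewrite big_cons.
by case: (p i) => //; exact: measurable_maxr.
Qed.

(** Disposes of the server choice, which is only known to be measurable value
    by value. *)
Lemma measurable_finite_choice (F : finType) (s : T -> F) (g : F -> T -> T') :
    (forall f, measurable (s @^-1` [set f])) ->
    (forall f, measurable_fun setT (g f)) ->
  measurable_fun setT (fun w => g (s w) w).
Proof.
move=> ms mg _ Y mY; rewrite setTI.
rewrite (_ : _ @^-1` Y = \bigcup_(f in [set: F]) (s @^-1` [set f] `&` g f @^-1` Y)).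
  apply: fin_bigcup_measurable; first exact: finite_finset.
  move=> f _; apply: measurableI => //.
  by rewrite -[X in measurable X]setTI; exact: mg.
apply/seteqP; split => w /=; first by move=> gY; exists (s w).
by move=> [f _ [<-]].
Qed.

Lemma measurable_peak N (f : T -> N.-tuple R) :
  measurable_fun setT f -> measurable_fun setT (fun w => peak (f w)).
Proof.
by move=> mf; apply: measurable_bigmax => // k; exact: (measurable_fun_tnthP f).1.
Qed.

Context {N nF nJ : nat}.
Hypothesis nJF : (1 <= nJ <= nF)%N.

Lemma measurable_waits (v : T -> N.-tuple R) (s : {ffun 'I_nF -> 'I_N}) :
  measurable_fun setT v -> measurable_fun setT (fun w => waits (v w) s).
Proof.
by move=> mv; apply: measurable_mktuple => i; exact: (measurable_fun_tnthP v).1.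
Qed.

Lemma measurable_completion (v : T -> N.-tuple R) (s : {ffun 'I_nF -> 'I_N})
    (b : T -> nF.-tuple R) i :
  measurable_fun setT v -> measurable_fun setT b ->
  measurable_fun setT (fun w => tnth (waits (v w) s) i + tnth (b w) i).
Proof.
move=> mv mb; apply: measurable_funD; last exact: (measurable_fun_tnthP b).1.
exact: (measurable_fun_tnthP _).1 (measurable_waits s mv) i.
Qed.

Lemma measurable_response (v : T -> N.-tuple R) (s : {ffun 'I_nF -> 'I_N})
    (b : T -> nF.-tuple R) :
  measurable_fun setT v -> measurable_fun setT b ->
  measurable_fun setT (fun w => response nJ (v w) s (b w)).
Proof.
move=> mv mb; apply: measurable_ordstat => //; apply: measurable_mktuple => i.
exact: measurable_completion.
Qed.

Lemma measurable_next_workload (v : T -> N.-tuple R)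
    (s : {ffun 'I_nF -> 'I_N}) (b : T -> nF.-tuple R) (a : T -> R) :
  measurable_fun setT v -> measurable_fun setT b -> measurable_fun setT a ->
  measurable_fun setT (fun w => next_workload nJ (v w) s (b w) (a w)).
Proof.
move=> mv mb ma; apply: measurable_mktuple => k.
apply: measurable_maxr => //; apply: measurable_funB => //.
under eq_fun do rewrite tnth_mktuple.
apply: measurable_bigmax => [|i]; first exact: (measurable_fun_tnthP v).1.
by apply: measurable_minr; [exact: measurable_completion|exact: measurable_response].
Qed.

End Measurability.

(** * Expectations and the maximum principle *)

Section Expectation.
Context d (T : measurableType d) (R : realType) (P : probability T R).
Implicit Types (f g : T -> R) (A B : set T).

Notation pr A := (fine (P A)).
Notation "''E' f" := (Rintegral P setT f) (at level 10, f at level 8).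
Notation itg f := (P.-integrable setT (EFin \o f)).

Lemma measurable_le_set f g : measurable_fun setT f -> measurable_fun setT g ->
  measurable [set w | f w <= g w].
Proof.
move=> mf mg; rewrite -[X in measurable X]setTI.
by have := measurable_fun_ler mf mg; apply.
Qed.

Lemma measurable_lt_set f g : measurable_fun setT f -> measurable_fun setT g ->
  measurable [set w | f w < g w].
Proof.
move=> mf mg; rewrite -[X in measurable X]setTI.
by have := measurable_fun_ltr mf mg; apply.
Qed.

Lemma pr_fin A : measurable A -> P A \is a fin_num.
Proof. by move=> mA; exact: fin_num_measure. Qed.

Lemma pr_ge0 A : 0 <= pr A.
Proof. exact: fine_ge0. Qed.

Lemma pr_le1 A : measurable A -> pr A <= 1.
Proof. by move=> mA; rewrite -lee_fin fineK ?pr_fin// probability_le1. Qed.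

Lemma pr_le A B : measurable A -> measurable B -> A `<=` B -> pr A <= pr B.
Proof. by move=> mA mB AB; rewrite fine_le ?pr_fin// le_measure ?inE. Qed.

Lemma pr_U A B : measurable A -> measurable B -> [disjoint A & B] ->
  pr (A `|` B) = pr A + pr B.
Proof.
by move=> mA mB /disj_set2P AB; rewrite measureU// fineD ?pr_fin.
Qed.

Lemma pr_U_le A B : measurable A -> measurable B -> pr (A `|` B) <= pr A + pr B.
Proof.
move=> mA mB; rewrite -fineD ?pr_fin// fine_le ?fin_numD ?pr_fin//.
  exact: measurableU.
exact: measureU2.
Qed.

Lemma prod_pr (I : Type) (l : seq I) (E : I -> set T) :
    (forall i, measurable (E i)) ->
  (\prod_(i <- l) P (E i) = (\prod_(i <- l) pr (E i))%:E)%E.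
Proof.
move=> mE; elim: l => [|i l IH]; first by rewrite !big_nil.
by rewrite !big_cons IH EFinM fineK ?pr_fin.
Qed.

Lemma itg_measurable f : itg f -> measurable_fun setT f.
Proof. by move=> itf; apply/measurable_EFinP; exact: measurable_int itf. Qed.

Lemma itg_dom f g : measurable_fun setT f -> (forall w, `|f w| <= g w) ->
  itg g -> itg f.
Proof.
move=> mf fg; apply: le_integrable => //; first exact/measurable_EFinP.
by move=> w _ /=; rewrite lee_fin (le_trans (fg w))// ler_norm.
Qed.

Lemma itg_cst c : itg (cst c).
Proof. exact: finite_measure_integrable_cst. Qed.

Lemma itg_bnd f c : measurable_fun setT f -> (forall w, `|f w| <= c) -> itg f.
Proof. by move=> mf fc; apply: itg_dom (itg_cst c). Qed.

Lemma itg_indic A : measurable A -> itg \1_A.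
Proof.
move=> mA; apply: (itg_bnd (c := 1)); first exact: measurable_indic.
by move=> w; rewrite indicE; case: (_ \in _); rewrite ?normr1 ?normr0.
Qed.

Lemma itg_D f g : itg f -> itg g -> itg (fun w => f w + g w).
Proof. by move=> /integrableD h /h; apply. Qed.

Lemma itg_B f g : itg f -> itg g -> itg (fun w => f w - g w).
Proof. by move=> /integrableB h /h; apply. Qed.

Lemma itg_Z c f : itg f -> itg (fun w => c * f w).
Proof. by move=> /integrableZl; apply. Qed.

Lemma Ex_cst c : 'E (fun=> c) = c.
Proof. by rewrite Rintegral_cst//= probability_setT mulr1. Qed.

Lemma Ex_indic A : measurable A -> 'E \1_A = pr A.
Proof. by move=> mA; rewrite /Rintegral integral_indic// setIT. Qed.

Lemma Ex_le f g : itg f -> itg g -> (forall w, f w <= g w) -> 'E f <= 'E g.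
Proof. by move=> itf itg' fg; apply: le_Rintegral. Qed.

Lemma Ex_D f g : itg f -> itg g -> 'E (fun w => f w + g w) = 'E f + 'E g.
Proof. by move=> itf itg'; apply: RintegralD. Qed.

Lemma Ex_B f g : itg f -> itg g -> 'E (fun w => f w - g w) = 'E f - 'E g.
Proof. by move=> itf itg'; apply: RintegralB. Qed.

Lemma Ex_Z c f : itg f -> 'E (fun w => c * f w) = c * 'E f.
Proof. by move=> itf; apply: RintegralZl. Qed.

(** Let [m > 0] be the supremum of [f]. As [u] vanishes, [f <= m / 2] beyond
    some level. One step to the left of a half-line on which [f <= m - e], the
    increment [Y] leads back into it with probability at least [p], so there
    [f <= m - p e]. Finitely many steps of length [dl] cover [[x0, +oo[] and
    bound [f] by a constant below its supremum. *)
Lemma maximum_principle (Y : T -> R) (f u : R -> R) (dl c x0 : R) :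
    measurable_fun setT Y -> measurable_fun setT f ->
    (forall x, f x <= u x) -> {homo u : x y /~ x <= y} ->
    (forall e, 0 < e -> exists x, u x <= e) ->
    (forall x, f x <= c) ->
    0 < dl -> 0 < pr [set w | dl <= Y w] ->
    (forall x, 0 < f x ->
      x0 <= x /\ f x <= 'E (fun w => Num.max 0 (f (x + Y w)))) ->
  forall x, f x <= 0.
Proof.
move=> mY mf fu u_ni u0 fc dl0; set p := pr _ => p0 fE x1.
rewrite leNgt; apply/negP => fx1.
have mD : measurable [set w | dl <= Y w].
  exact: measurable_le_set.
have p1 : p <= 1 by exact: pr_le1.
pose m := sup (range f).
have hs : has_sup (range f).
  by split; [exists (f x1), x1|exists c => _ [x _ <-]].
have fm x : f x <= m by apply: sup_upper_bound => //; exists x.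
have m0 : 0 < m by exact: lt_le_trans (fm x1).
have [x2 ux2] := u0 (m / 2) (divr_gt0 m0 (ltr0Sn _ 1)).
have [N hN] : exists N : nat, x2 <= x0 + N%:R * dl.
  exists (Num.trunc (`|x2 - x0| / dl)).+1.
  rewrite -lerBlDl (le_trans (ler_norm _))// -ler_pdivrMr// ltW//.
  by rewrite -[ltRHS]natr1 natr1 truncnS_gt.
have hq k : p ^+ k * (m / 2) <= m / 2.
  by rewrite ler_piMl ?(ltW (divr_gt0 _ _))//; apply: exprn_ile1 => //; exact: ltW.
(* [N] steps of length [dl] lead from [x0] into the region where
   [f <= m / 2]. *)
have step k : (k <= N)%N -> forall x, x0 + (N - k)%:R * dl <= x ->
    f x <= m - p ^+ k * (m / 2).
  elim: k => [_ x|k IH kN x xk].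
    rewrite subn0 expr0 mul1r => xN.
    apply: (le_trans (fu x)); apply: (le_trans (u_ni _ _ (le_trans hN xN))).
    lra.
  have q0 : 0 <= p ^+ k * (m / 2).
    by rewrite mulr_ge0 ?exprn_ge0 ?divr_ge0 ?ltW.
  have q1 := hq k.
  have [fx0|/fE[x0x fx]] := leP (f x) 0.
    by have := hq k.+1; lra.
  apply: (le_trans fx); set q := p ^+ k * (m / 2) in q0 q1.
  pose g w := m - q * \1_[set w | dl <= Y w] w.
  have ig : itg g.
    by apply: itg_B (itg_cst m) _; apply: itg_Z; exact: itg_indic.
  have fg w : Num.max 0 (f (x + Y w)) <= g w.
    rewrite /g indicE; have [|] := boolP (w \in _) => /=.
      rewrite inE/= => Yw; rewrite mulr1 ge_max; apply/andP; split; first lra.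
      apply: IH; first exact: ltnW.
      move: xk Yw; rewrite /= -(subnSK kN) -natr1 mulrDl mul1r; lra.
    by rewrite mulr0 subr0 ge_max fm ltW.
  apply: (le_trans (Ex_le _ ig fg)).
    apply: (itg_bnd (c := m)) => [|w].
      apply: measurable_maxr => //; apply: measurableT_comp => //.
      exact: measurable_funD.
    by rewrite ger0_norm ?le_max ?lexx// ge_max fm ltW.
  rewrite Ex_B ?Ex_cst; last 2 first.
  - exact: itg_cst.
  - by apply: itg_Z; exact: itg_indic.
  by rewrite Ex_Z ?Ex_indic//; [rewrite exprSr mulrAC|exact: itg_indic].
suff : m <= m - p ^+ N * (m / 2).
  by rewrite lerBrDr gerDl leNgt mulr_gt0 ?exprn_gt0 ?divr_gt0.
apply: ge_sup => [|_ [x _ <-]]; first by case: hs.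
have [x0x|xx0] := leP x0 x.
  by apply: (step N) => //; rewrite subnn mul0r addr0.
have [fx0|/fE[]] := leP (f x) 0; last by rewrite leNgt xx0.
by have := hq N; lra.
Qed.

End Expectation.

(** * Independence *)

Section Independence.
Context d (T : measurableType d) (R : realType) (P : probability T R).
Local Open Scope ereal_scope.

(** Rectangles form a pi-system that generates the product sigma-algebra, and
    both sides are finite measures in [X]. *)
Lemma indep_pair d1 d2 (T1 : measurableType d1) (T2 : measurableType d2)
    (C : set T) (f : T -> T1) (g : T -> T2) :
    measurable C -> measurable_fun setT f -> measurable_fun setT g ->
    (forall E F, measurable E -> measurable F ->
      P (C `&` (f @^-1` E `&` g @^-1` F)) = P C * P (f @^-1` E `&` g @^-1` F)) ->
  forall X, measurable X ->
    P (C `&` (fun w => (f w, g w)) @^-1` X) =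
    P C * P ((fun w => (f w, g w)) @^-1` X).
Proof.
move=> mC mf mg rect X mX.
have mh : measurable_fun setT (fun w => (f w, g w)) by exact: measurable_fun_pair.
pose h : {mfun T >-> (T1 * T2)%type} := HB.pack (fun w => (f w, g w))
  (isMeasurableFun.Build _ _ _ _ _ mh).
have pC : (0 <= fine (P C))%R by exact: fine_ge0.
pose p : {nonneg R} := NngNum pC.
pose m0 : {measure set (T1 * T2) -> \bar R} := pushforward (mrestr P mC) h.
pose m1 := m0 mh.
pose m2 : {measure set (T1 * T2) -> \bar R} := mscale p (distribution P h).
have pE : p%:num%:E = P C by rewrite /= fineK// fin_num_measure.
suff : m1 X = m2 X.
  rewrite /m1 /m0 /m2 /= /mscale /distribution pE /pushforward /mrestr setIC.

  by [].

pose G : set (set (T1 * T2)) :=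
  [set A `*` B | A in measurable & B in measurable].
apply: (measure_unique G (fun=> setT)) => //.
- by rewrite measurable_prod_measurableType.
- move=> _ _ [E mE [F mF <-]] [E' mE' [F' mF' <-]].
  by rewrite -setXI; exists (E `&` E'); [exact: measurableI|
    exists (F `&` F') => //; exact: measurableI].
- by move=> _; exists setT => //; exists setT => //; rewrite setXTT.
- by rewrite bigcup_const.
- move=> _ [E mE [F mF <-]].
  rewrite /m1 /m0 /m2 /= /mscale /distribution pE /pushforward /mrestr setIC.
  exact: rect.
- move=> _; rewrite -ge0_fin_numE//; apply: fin_num_measure => //.
  exact: measurableT.

Qed.

(** The joint law is the product of the laws, so the probability can be
    computed by conditioning on [Y]. *)
Lemma indep_add (X Y : T -> R) (x : R) :
    measurable_fun setT X -> measurable_fun setT Y ->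
    (forall E F, measurable E -> measurable F ->
      P (X @^-1` E `&` Y @^-1` F) = P (X @^-1` E) * P (Y @^-1` F)) ->
  P [set w | (x < X w + Y w)%R] = \int[P]_w P [set w' | (x - Y w < X w')%R].
Proof.
move=> mX mY XY.
pose X' : {mfun T >-> R} := HB.pack X (isMeasurableFun.Build _ _ _ _ _ mX).
pose Y' : {mfun T >-> R} := HB.pack Y (isMeasurableFun.Build _ _ _ _ _ mY).
have mh : measurable_fun setT (fun w => (Y w, X w)) by exact: measurable_fun_pair.
pose h : {mfun T >-> (R * R)%type} := HB.pack (fun w => (Y w, X w))
  (isMeasurableFun.Build _ _ _ _ _ mh).
pose D := [set z : R * R | (x < z.2 + z.1)%R].
have mD : measurable D.
  by apply: measurable_lt_set => //; exact: measurable_funD.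
have -> : P [set w | (x < X w + Y w)%R] = distribution P h D by [].
have pmu E F : measurable E -> measurable F ->
    distribution P h (E `*` F) = distribution P Y' E * distribution P X' F.
  by move=> mE mF; rewrite /distribution /pushforward muleC -XY// setIC.
rewrite -(product_measure_unique pmu mD).
rewrite /product_measure1 ge0_integral_pushforward//; last first.
  exact: measurable_fun_xsection.
apply: eq_integral => w _; rewrite /= /distribution /pushforward.
congr (P _); apply/seteqP; split => w' /=; rewrite /xsection /= inE /D/= ltrBlDr//.
Qed.

End Independence.

(** * Tails *)

Section Tails.
Context d (T : measurableType d) (R : realType) (P : probability T R).
Notation pr A := (fine (P A)).
Notation "''E' f" := (Rintegral P setT f) (at level 10, f at level 8).
Notation itg f := (P.-integrable setT (EFin \o f)).

Lemma indep_add_tail (X Y : T -> R) (x : R) :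
    measurable_fun setT X -> measurable_fun setT Y ->
    (forall E F, measurable E -> measurable F ->
      P (X @^-1` E `&` Y @^-1` F) = (P (X @^-1` E) * P (Y @^-1` F))%E) ->
  tail P (fun w => X w + Y w) x = 'E (fun w => tail P X (x - Y w)).
Proof.
move=> mX mY XY; rewrite /tail indep_add// /Rintegral; congr fine.
by apply: eq_integral => w _; rewrite fineK// pr_fin//; exact: measurable_lt_set.
Qed.

Section OneVariable.
Variable X : T -> R.
Hypothesis mX : measurable_fun setT X.

Lemma measurable_gt (x : R) : measurable [set w | x < X w].
Proof. exact: measurable_lt_set. Qed.

Lemma tail_ni : {homo tail P X : x y /~ x <= y}.
Proof.
move=> y x xy; apply: pr_le; try exact: measurable_gt.
by move=> w /=; exact: le_lt_trans.
Qed.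

Lemma measurable_tail : measurable_fun setT (tail P X).
Proof. by apply: nonincreasing_measurable => // x y; exact: tail_ni. Qed.

Lemma tail_ge0 x : 0 <= tail P X x.
Proof. exact: fine_ge0. Qed.

Lemma tail_le1 x : tail P X x <= 1.
Proof. exact/pr_le1/measurable_gt. Qed.

Lemma tail_vanish (e : R) : 0 < e -> exists x, tail P X x <= e.
Proof.
move=> e0.
pose X' : {RV P >-> R} := HB.pack X (isMeasurableFun.Build _ _ _ _ _ mX).
have /fine_cvgP[_ /cvgrPdist_le/(_ e e0)] := @cvg_ccdfy0 _ _ _ P X'.
case=> M [_ HM]; exists (M + 1).
have /HM : M < M + 1 by rewrite ltrDl.
rewrite sub0r normrN ger0_norm/= ?fine_ge0// => /(le_trans _); apply.
by rewrite /tail /ccdf /distribution /pushforward preimage_itvoy.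
Qed.
End OneVariable.

Lemma pr_le_tailE (f : T -> R) x : measurable_fun setT f ->
  pr [set w | f w <= x] = 1 - tail P f x.
Proof.
move=> mf; apply/eqP; rewrite eq_sym subr_eq /tail -pr_U.
- rewrite (_ : _ `|` _ = setT) ?probability_setT//.
  by apply/seteqP; split => w // _ /=; case: (leP (f w) x); [left|right].
- exact: measurable_le_set.
- exact: measurable_gt.
- apply/disj_set2P/seteqP; split => // w [] /= h1 h2.
  by have := le_lt_trans h1 h2; rewrite ltxx.
Qed.

Lemma Ex_minK (Y : T -> R) (e : R) : itg Y -> (forall w, 0 <= Y w) -> 0 < e ->
  exists2 K, 0 < K & 'E Y - e <= 'E (fun w => Num.min (Y w) K).
Proof.
move=> iY Y0 e0.
have mY : measurable_fun setT Y by exact: itg_measurable iY.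
pose f (n : nat) w := (Num.min (Y w) n.+1%:R)%:E.
have [] := @dominated_convergence _ _ _ P setT measurableT f (EFin \o Y) (EFin \o Y).
- move=> n; apply/measurable_EFinP; exact: measurable_minr.
- exact: measurable_int iY.
- apply: aeW => w _; apply: cvg_near_cst; near=> n.
  rewrite /f /= min_l//; near: n.
  exists (Num.trunc (Y w)) => // n /= hn.
  by rewrite ltW// (lt_le_trans (truncnS_gt _))// ler_nat ltnS.
- exact: iY.
- apply: aeW => w n _; rewrite /f /= lee_fin ger0_norm ?ge_min ?lexx//.
  by rewrite le_min Y0 ler0n.
move=> _ _; rewrite -(fineK (integrable_fin_num measurableT iY)).
move=> /fine_cvgP[_ /cvgrPdist_le/(_ e e0)[N _ HN]].
exists N.+1%:R => //.
have := HN N (leqnn N); rewrite /= => /ler_normlP[_].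
rewrite /Rintegral lerBlDr -lerBlDl /f; lra.
Unshelve. all: by end_near. Qed.

(** By the layer-cake formula, the expectation of the part of [X] above [x] is
    the integral of its tail over [[x, +oo[], and likewise for [Y]. *)
Lemma stop_loss_le (X Y : T -> R) (c x : R) :
    itg (fun w => Num.max 0 (X w - x)) -> itg (fun w => Num.max 0 (Y w - x)) ->
    0 <= c -> (forall y, x <= y -> tail P X y <= c * tail P Y y) ->
  'E (fun w => Num.max 0 (X w - x)) <= c * 'E (fun w => Num.max 0 (Y w - x)).
Proof.
move=> iX iY c0 XY.
have layer (Z : T -> R) : itg Z -> (forall w, 0 <= Z w) ->
    ('E Z)%:E = (\int[lebesgue_measure]_(r in `[0%R, +oo[) (tail P Z r)%:E)%E.
  move=> iZ Z0.
  have mZ : measurable_fun setT Z by exact: itg_measurable iZ.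
  pose Z' : {RV P >-> R} := HB.pack Z (isMeasurableFun.Build _ _ _ _ _ mZ).
  have := @ge0_expectation_ccdf _ _ _ P Z' Z0.
  rewrite unlock => E; rewrite /Rintegral fineK; last exact: integrable_fin_num.
  rewrite E; apply: eq_integral => r _.
  rewrite /tail fineK ?pr_fin//; last exact: measurable_gt.
  by rewrite /ccdf /distribution /pushforward preimage_itvoy.
have tailE (Z : T -> R) r : 0 <= r ->
    tail P (fun w => Num.max 0 (Z w - x)) r = tail P Z (x + r).
  move=> r0; congr (fine (P _)); apply/seteqP; split => w /=;
    by rewrite lt_max ltNge r0/= ltrBrDl.
have mpos (Z : T -> R) : itg Z -> measurable_fun setT (EFin \o tail P Z).
  move=> iZ; apply/measurable_EFinP; apply: measurable_tail.
  exact: itg_measurable iZ.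
rewrite -lee_fin EFinM !layer//; do ?by move=> w; rewrite le_max lexx.
rewrite -ge0_integralZl//; last 2 first.
- by apply: (measurable_funS measurableT) => //; exact: mpos.
- by move=> r _; rewrite lee_fin tail_ge0.
apply: ge0_le_integral => //.
- by move=> r _; rewrite lee_fin tail_ge0.
- by apply: (measurable_funS measurableT) => //; exact: mpos.
- apply: (measurable_funS measurableT) => //; apply/measurable_EFinP; apply: measurable_funM => //.
  by apply/measurable_EFinP; exact: mpos.
move=> r; rewrite /= in_itv/= andbT => r0.
by rewrite -EFinM lee_fin !tailE// XY// lerDl.
Qed.

End Tails.

(** * Regular variation and the integrated tail *)

Section RegularVariation.
Context d (T : measurableType d) (R : realType) (P : probability T R).
Variables (X : T -> R) (r : R).
Hypotheses (mX : measurable_fun setT X) (rvX : regularly_varying P X r).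
Notation pr A := (fine (P A)).
Notation "''E' f" := (Rintegral P setT f) (at level 10, f at level 8).
Notation itg f := (P.-integrable setT (EFin \o f)).
Notation F := (tail P X).

Lemma regvar_gt0 x : 0 < F x.
Proof.
have [L svL FE] := rvX.
have /cvgrPdist_lt/(_ 1 ltr01)[M [_ HM]] := svL 2 (ltr0Sn _ 1).
pose y := Num.max (Num.max x 0) M + 1.
have xy : x <= y by rewrite -[x]addr0 lerD// !le_max lexx.
have y0 : 0 < y by rewrite ltr_wpDl// !le_max lexx orbT.
have /HM/= : M < y by rewrite ltr_pwDr// !le_max lexx orbT.
have Ly : `|1 - L (2 * y) / L y| < 1 -> L y != 0.
  by move=> h; apply/eqP => L0; move: h; rewrite L0 invr0 mulr0 subr0 normr1 ltxx.
move=> /Ly L0; apply: (lt_le_trans _ (tail_ni P mX xy)).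
by rewrite lt_neqAle tail_ge0 andbT eq_sym FE// mulf_neq0// gt_eqF// powR_gt0.
Qed.

Lemma regvar_cvg a : 0 < a -> F (a * x) / F x @[x --> +oo] --> a `^ r.
Proof.
move=> a0; have [L svL FE] := rvX.
rewrite -[X in _ --> X]mul1r.
have h : L (a * x) / L x * a `^ r @[x --> +oo] --> 1 * a `^ r.
  by apply: cvgM; [exact: svL|exact: cvg_cst].
apply: cvg_trans h; apply: near_eq_cvg; near=> x.
have x0 : 0 < x by near: x; exact: nbhs_pinfty_gt.
rewrite !FE ?mulr_gt0// powRM ?ltW//.
have xr : x `^ r != 0 by rewrite gt_eqF// powR_gt0.
have [->|Lx] := eqVneq (L x) 0; first by rewrite !(invr0, mul0r, mulr0).
by field; rewrite xr Lx.
Unshelve. all: by end_near. Qed.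

Lemma regvar_le a th : 0 < a -> a `^ r < th ->
  exists x0, forall x, x0 <= x -> F (a * x) <= th * F x.
Proof.
move=> a0 ath.
have [M [_ HM]] := cvgr_lt _ (regvar_cvg a0) _ ath.
exists (M + 1) => x Mx.
have /HM/= : M < x by rewrite (lt_le_trans _ Mx)// ltrDl.
by rewrite ltr_pdivrMr ?regvar_gt0// => /ltW.
Qed.

Lemma regvar_ge a th : 0 < a -> th < a `^ r ->
  exists x0, forall x, x0 <= x -> th * F x <= F (a * x).
Proof.
move=> a0 ath.
have [M [_ HM]] := cvgr_gt _ (regvar_cvg a0) _ ath.
exists (M + 1) => x Mx.
have /HM/= : M < x by rewrite (lt_le_trans _ Mx)// ltrDl.
by rewrite ltr_pdivlMr ?regvar_gt0// => /ltW.
Qed.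

End RegularVariation.

(** Regularly varying tails are asymptotically insensitive to relative
    perturbations of the argument: one of size [e] costs at most a factor
    [th]. *)
Lemma powR_near1 (R : realType) (r th : R) : 1 < th ->
  exists2 e : R, 0 < e < 1 & (1 - e) `^ r < th /\ th^-1 < (1 + e) `^ r.
Proof.
move=> th1.
have c1 : {for 1, continuous (fun a : R => a `^ r)}.
  apply: differentiable_continuous; apply/derivable1_diffP.
  by apply: derivable_powR; rewrite in_itv/= ltr01.
have h1 : a `^ r @[a --> (1 : R)] --> (1 : R).
  by have := c1; rewrite /prop_for /continuous_at powR1.
have h : th^-1 < 1 by rewrite invf_lt1// (lt_trans ltr01).
have [/= dl dl0 H] : \forall a \near (1 : R), th^-1 < a `^ r < th.
  near=> a; apply/andP; split; near: a.
    exact: (cvgr_gt _ h1 _ h).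
  exact: (cvgr_lt _ h1 _ th1).
pose e := Num.min dl 1 / 2.
have m0 : 0 < Num.min dl 1 by rewrite lt_min dl0 ltr01.
have e0 : 0 < e by rewrite divr_gt0.
have edl : e < dl.
  have : Num.min dl 1 <= dl by rewrite ge_min lexx.
  by rewrite /e; lra.
have e1 : e < 1.
  have : Num.min dl 1 <= 1 by rewrite ge_min lexx orbT.
  by rewrite /e; lra.
exists e; first by rewrite e0.
split.
  have /andP[] // : th^-1 < (1 - e) `^ r < th.
  by apply: H => /=; rewrite opprD addNKr opprK gtr0_norm.
have /andP[] // : th^-1 < (1 + e) `^ r < th.
by apply: H => /=; rewrite opprD addNKr normrN gtr0_norm.
Unshelve. all: by end_near. Qed.

Section Excess.
Context d (T : measurableType d) (R : realType) (P : probability T R).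
Variables (X : T -> R).
Notation "''E' f" := (Rintegral P setT f) (at level 10, f at level 8).
Notation itg f := (P.-integrable setT (EFin \o f)).
Hypothesis (iX : itg X).
Notation F := (tail P X).

(** The integrated tail of [X], written as an expectation so that its
    increments can be compared with the tail pointwise. *)
Definition excess (x : R) : R := 'E (fun w => Num.max 0 (X w - x)).
Notation G := excess.

Let mX : measurable_fun setT X.
Proof. exact: itg_measurable iX. Qed.

Lemma itg_excess x : itg (fun w => Num.max 0 (X w - x)).
Proof.
apply: (itg_dom (g := fun w => `|X w| + `|x|)).
- by apply: measurable_maxr => //; exact: measurable_funB.
- move=> w; rewrite ger0_norm ?le_max ?lexx// ge_max addr_ge0//=.
  by rewrite (le_trans (ler_norm _))// ler_normB.
- by apply: itg_D (itg_cst P `|x|); exact: integrable_norm iX.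
Qed.

Lemma excess_ge0 x : 0 <= G x.
Proof. by apply: Rintegral_ge0 => w _; rewrite le_max lexx. Qed.

Lemma excess_diff_le x y : x <= y -> G x - G y <= (y - x) * F x.
Proof.
move=> xy; rewrite /excess -Ex_B ?itg_excess// /tail -Ex_indic; last exact: measurable_gt.
have iI : itg \1_[set w | x < X w] by apply/itg_indic/measurable_gt.
rewrite -Ex_Z//; apply: Ex_le; [by apply: itg_B; exact: itg_excess|exact: itg_Z|].
move=> w; rewrite indicE; case: (boolP (w \in _)).
  by rewrite inE /= => xw;
    rewrite ?mulr1 ?mulr0; case: (leP 0 (X w - x)) => h1;
    case: (leP 0 (X w - y)) => h2; lra.
by rewrite notin_setE /= => /negP; rewrite -leNgt => xw;
    rewrite ?mulr1 ?mulr0; case: (leP 0 (X w - x)) => h1;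
    case: (leP 0 (X w - y)) => h2; lra.
Qed.

Lemma excess_diff_ge x y : x <= y -> (y - x) * F y <= G x - G y.
Proof.
move=> xy; rewrite /excess -Ex_B ?itg_excess// /tail -Ex_indic; last exact: measurable_gt.
have iI : itg \1_[set w | y < X w] by apply/itg_indic/measurable_gt.
rewrite -Ex_Z//; apply: Ex_le; [exact: itg_Z|by apply: itg_B; exact: itg_excess|].
move=> w; rewrite indicE; case: (boolP (w \in _)).
  by rewrite inE /= => xw;
    rewrite ?mulr1 ?mulr0; case: (leP 0 (X w - x)) => h1;
    case: (leP 0 (X w - y)) => h2; lra.
by rewrite notin_setE /= => /negP; rewrite -leNgt => xw;
    rewrite ?mulr1 ?mulr0; case: (leP 0 (X w - x)) => h1;
    case: (leP 0 (X w - y)) => h2; lra.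
Qed.

Lemma excess_ni : {homo G : x y /~ x <= y}.
Proof.
move=> y x xy; rewrite -subr_ge0; apply: le_trans (excess_diff_ge xy).
by rewrite mulr_ge0 ?tail_ge0// subr_ge0.
Qed.

Lemma excess_vanish (e : R) : (forall w, 0 <= X w) -> 0 < e ->
  exists x, G x <= e.
Proof.
move=> X0 e0; have [K K0 HK] := Ex_minK iX X0 e0.
exists K; move: HK; rewrite lerBlDl -lerBlDr; apply: le_trans.
have iM : itg (fun w => Num.min (X w) K).
  apply: itg_dom iX => [|w]; first exact: measurable_minr.
  by rewrite ger0_norm; [rewrite ge_min lexx|rewrite le_min X0 ltW].
rewrite -Ex_B//; apply: Ex_le; [exact: itg_excess|exact: itg_B|].
by move=> w; case: (leP 0 (X w - K)) => h1; case: (leP (X w) K) => h2; lra.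
Qed.

(** Substituting [a * y] for the variable of integration gives the factor [a],
    and the comparison of the tails the factor [th]. *)
Lemma excess_scale_le a th x : 0 < a -> 0 <= th ->
  (forall y, x <= y -> F (a * y) <= th * F y) -> G (a * x) <= a * th * G x.
Proof.
move=> a0 th0 H.
have aN0 : a != 0 by rewrite gt_eqF.
have E w : Num.max 0 (X w - a * x) = a * Num.max 0 (X w / a - x).
  by rewrite maxr_pMr ?ltW// mulr0 mulrBr mulrCA mulfV// mulr1.
have iY : itg (fun w => Num.max 0 (X w / a - x)).
  have := itg_Z a^-1 (itg_excess (a * x)).
  by apply: eq_integrable => // w _ /=; rewrite E mulrA mulVf// mul1r.
rewrite /excess (_ : (fun w => _) = (fun w => a * Num.max 0 (X w / a - x))); last first.
  by apply/funext => w.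
rewrite Ex_Z// -mulrA ler_pM2l//; apply: stop_loss_le => //; first exact: itg_excess.
move=> y /H; apply: le_trans; rewrite /tail.
rewrite (_ : [set w | y < X w / a] = [set w | a * y < X w])//.
by apply/seteqP; split => w /=; rewrite ltr_pdivlMr// mulrC.
Qed.

Lemma excess_scale_ge a th x : 0 < a -> 0 < th ->
  (forall y, x <= y -> th * F y <= F (a * y)) -> a * th * G x <= G (a * x).
Proof.
move=> a0 th0 H.
have aN0 : a != 0 by rewrite gt_eqF.
have E w : Num.max 0 (X w - a * x) = a * Num.max 0 (X w / a - x).
  by rewrite maxr_pMr ?ltW// mulr0 mulrBr mulrCA mulfV// mulr1.
have iY : itg (fun w => Num.max 0 (X w / a - x)).
  have := itg_Z a^-1 (itg_excess (a * x)).
  by apply: eq_integrable => // w _ /=; rewrite E mulrA mulVf// mul1r.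
rewrite /excess (_ : (fun w => Num.max _ (X w - a * _)) =
  (fun w => a * Num.max 0 (X w / a - x))); last first.
  by apply/funext => w.
rewrite Ex_Z// -mulrA ler_pM2l// -ler_pdivlMl//.
apply: stop_loss_le => //; [exact: itg_excess|by rewrite invr_ge0 ltW|].
move=> y /H; rewrite ler_pdivlMl// => /le_trans; apply; rewrite /tail.
rewrite (_ : [set w | y < X w / a] = [set w | a * y < X w])//.
by apply/seteqP; split => w /=; rewrite ltr_pdivlMr// mulrC.
Qed.

End Excess.

(** * Comparing a stationary tail with the integrated tail *)

Section TailComparison.
Context d (T : measurableType d) (R : realType) (P : probability T R).
Notation pr A := (fine (P A)).
Notation "''E' f" := (Rintegral P setT f) (at level 10, f at level 8).
Notation itg f := (P.-integrable setT (EFin \o f)).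

Lemma pr_ge_gt0 (Y : T -> R) (K y : R) : itg Y -> (forall w, Y w <= K) ->
  y < 'E Y -> 0 < pr [set w | y <= Y w].
Proof.
move=> iY YK yE; have mY : measurable_fun setT Y.
  exact: itg_measurable iY.
have mD : measurable [set w | y <= Y w] by exact: measurable_le_set.
rewrite lt_neqAle pr_ge0 andbT; apply/eqP => p0; move: yE; apply/negP.
rewrite -leNgt.
have iI := itg_Z `|K - y| (itg_indic P mD).
apply: (@le_trans _ _ ('E (fun w => y + `|K - y| * \1_[set w | y <= Y w] w))).
  apply: Ex_le => //; first exact: (itg_D (itg_cst P y) iI).
  move=> w; rewrite indicE; case: (boolP (w \in _)) => /=.
    by rewrite mulr1 (le_trans (YK w))// -lerBlDl ler_norm.
  by rewrite notin_setE/= => /negP; rewrite -ltNge mulr0 addr0 => /ltW.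
by rewrite (Ex_D (itg_cst P y) iI) Ex_cst Ex_Z ?Ex_indic -?p0 ?mulr0 ?addr0//; exact: itg_indic.
Qed.

Variables (X : T -> R) (r : R).
Hypotheses (iX : itg X) (X_ge0 : forall w, 0 <= X w).
Hypothesis rvX : regularly_varying P X r.
Notation F := (tail P X).
Notation G := (excess P X).

Let mX : measurable_fun setT X.
Proof. exact: itg_measurable iX. Qed.

Lemma excess_gt0 x : 0 < G x.
Proof.
have h := excess_diff_ge iX (_ : x <= x + 1).
have : x <= x + 1 by rewrite lerDl.
move=> /(excess_diff_ge iX); have := regvar_gt0 mX rvX (x + 1).
have := excess_ge0 P X (x + 1); lra.
Qed.

(** Effect on [G] of a service time [z] followed by an interarrival time [y]:
    over the range of levels involved, the slope of [G] is at most
    [F ((1 - e) * x)] in absolute value when the service is added, and at least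
    [F (x + K)] when the idle period is subtracted. *)
Lemma excess_step (e K x z y : R) : 0 <= z <= e * x -> 0 <= y <= K ->
  G (x - (z - y)) <= G x + F ((1 - e) * x) * z - F (x + K) * y.
Proof.
move=> /andP[z0 zx] /andP[y0 yK].
have hy : x <= x + y by rewrite lerDl.
have hz : x - (z - y) <= x + y by lra.
have := excess_diff_le iX hz; have := excess_diff_ge iX hy.
have -> : x + y - x = y by lra.
have -> : x + y - (x - (z - y)) = z by lra.
have : y * F (x + K) <= y * F (x + y).
  by rewrite ler_wpM2l// tail_ni// lerD2l.
have : z * F (x - (z - y)) <= z * F ((1 - e) * x).
  by rewrite ler_wpM2l// tail_ni//; lra.
lra.
Qed.

(** The balance of the supersolution inequality, with [b] the mean service time
    and [m] the mean capped interarrival time. The drift contributes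
    [- C * dl * Fx]; half of it absorbs the error [C * K * F2 * F0], and the
    other half the probability [F0] of a long service. *)
Lemma drift_arith (th dl Fx F0 F1 F2 b m La C K g : R) :
    0 < th -> 0 < C -> 0 <= K -> 0 <= Fx -> 0 <= b -> 0 <= m -> 0 <= F0 ->
    F1 <= th * Fx -> th^-1 * Fx <= F2 -> F2 <= Fx -> F0 <= La * Fx ->
    K * F0 <= dl / 2 -> 2 * La <= C * dl -> dl = m / th - th * b ->
  (1 + C * (K * F2)) * F0 + C * (g + F1 * b - F2 * m) <= C * g.
Proof.
move=> th0 C0 K0 Fx0 b0 m0 F00 F1le F2ge F2le F0le KF0 La2 dlE.
have h1 : F1 * b <= th * Fx * b by rewrite ler_wpM2r.
have h2 : th^-1 * Fx * m <= F2 * m by rewrite ler_wpM2r.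
have h3 : K * F0 * F2 <= dl / 2 * Fx.
  apply: (@le_trans _ _ (K * F0 * Fx)); first by rewrite ler_wpM2l// mulr_ge0.
  by rewrite ler_wpM2r.
have h5 : F0 <= C * (dl / 2) * Fx.
  by rewrite (le_trans F0le)// ler_wpM2r//; lra.
have h6 : C * (K * F0 * F2 + F1 * b - F2 * m) <= C * (- (dl / 2) * Fx).
  rewrite ler_pM2l//.
  have -> : - (dl / 2) * Fx = dl / 2 * Fx + th * Fx * b - th^-1 * Fx * m.
    by rewrite dlE; field; rewrite gt_eqF.
  lra.
lra.
Qed.

(** If [M] is distributed as the stationary waiting time of a stable queue, its
    tail [t] satisfies [t x <= E t (x - Z)] with [Z := X - A] of negative mean,
    while [V := min 1 (C G)] satisfies [E V (x - Z) <= V x] wherever [V < 1].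
    The maximum principle applied to [t - V] then yields [t <= V]. *)
Lemma queue_tail_le (M A : T -> R) (K : R) :
    measurable_fun setT M -> measurable_fun setT A ->
    (forall w, 0 <= A w <= K) -> 'E X < 'E A ->
    (forall E D, measurable E -> measurable D ->
      P (M @^-1` E `&` (fun w => (X w - A w)%R) @^-1` D) =
      (P (M @^-1` E) * P ((fun w => (X w - A w)%R) @^-1` D))%E) ->
    (forall x, 0 <= x -> tail P M x <= tail P (fun w => M w + (X w - A w)) x) ->
  exists2 C, 0 < C & forall x, tail P M x <= C * G x.
Proof.
move=> mM mA A0K; set b := 'E X; set m := 'E A => bm ind stat.
have b0 : 0 <= b by apply: Rintegral_ge0 => w _; exact: X_ge0.
have m0 : 0 < m by exact: le_lt_trans bm.
have iA : itg A.
  apply: (itg_bnd P (c := K)) => // w.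
  by case/andP: (A0K w) => a0 aK; rewrite ger0_norm.
have K0 : 0 < K.
  rewrite (lt_le_trans m0)// -(Ex_cst P K); apply: Ex_le => //; first exact: itg_cst.
  by move=> w; have /andP[] := A0K w.
(* Leaves room for the factor [th] on both sides: [th ^ 2 * b < m]. *)
pose eta := (m - b) / (4 * m).
have etaE : eta * (4 * m) = m - b by rewrite /eta divfK// gt_eqF// mulr_gt0.
have eta0 : 0 < eta by rewrite divr_gt0 ?mulr_gt0// subr_gt0.
pose th := 1 + eta.
have th1 : 1 < th by rewrite ltrDl.
have th0 : 0 < th by rewrite (lt_trans ltr01).
have dl0 : 0 < m / th - th * b.
  rewrite subr_gt0 ltr_pdivlMr//.
  have -> : b = m * (1 - 4 * eta) by lra.
  rewrite /th.
  have me1 := mulr_gt0 m0 eta0; have me2 := mulr_gt0 me1 eta0.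
  have me3 := mulr_gt0 me2 eta0.
  lra.
set dl := m / th - th * b in dl0.
have [e /andP[e0 e1] [le1 ge1]] := powR_near1 r th1.
have e10 : 0 < 1 - e by rewrite subr_gt0.
have e20 : 0 < 1 + e by rewrite ltr_wpDl.
have [x1 H1] := regvar_le mX rvX e10 le1.
have [x2 H2] := regvar_ge mX rvX e20 ge1.
pose La := e `^ r + 1.
have La0 : 0 < La by rewrite ltr_wpDl// powR_ge0.
have [x3 H3] : exists x0, forall x, x0 <= x -> F (e * x) <= La * F x.
  by apply: (regvar_le mX rvX) => //; rewrite ltrDl.
have [x4 H4] := tail_vanish P mX (divr_gt0 dl0 (mulr_gt0 (ltr0Sn _ 1) K0)).
pose x0 := Num.max (Num.max (Num.max x1 x2) (Num.max x3 (x4 / e))) (K / e).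
have Ke0 : 0 <= K / e by rewrite divr_ge0// ltW.
(* The first entry makes the drift dominate the long services; the second makes
   [V] equal to 1 below [x0], so that nothing has to be shown there. *)
pose C := Num.max (2 * La / dl) (G x0)^-1.
have C1 : 2 * La / dl <= C by rewrite le_max lexx.
have C2 : 1 <= C * G x0.
  by rewrite -ler_pdivrMr ?excess_gt0// div1r le_max lexx orbT.
have C0 : 0 < C by rewrite (lt_le_trans _ C1)// divr_gt0// mulr_gt0.
pose V y := Num.min 1 (C * G y).
have V0 y : 0 <= V y by rewrite le_min ler01 mulr_ge0 ?excess_ge0// ltW.
have V1 y : V y <= 1 by rewrite ge_min lexx.
have mV : measurable_fun setT V.
  apply: nonincreasing_measurable => // y x yx; rewrite /V le_min ge_min lexx/=.
  by rewrite ge_min ler_pM2l// (excess_ni iX)// orbT.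
pose Z w := X w - A w.
have mZ : measurable_fun setT Z by exact: measurable_funB.
have mxZ x : measurable_fun setT (fun w => x - Z w) by exact: measurable_funB.
have iV x : itg (fun w => V (x - Z w)).
  apply: (itg_bnd P (c := 1)) => [|w]; last by rewrite ger0_norm.
  exact: measurableT_comp.
have super x : x0 <= x -> 'E (fun w => V (x - Z w)) <= C * G x.
  rewrite !ge_max => /andP[/andP[/andP[xx1 xx2] /andP[xx3 xx4]] xK].
  have x_ge0 : 0 <= x by exact: le_trans xK.
  set F1 := F ((1 - e) * x); set F2 := F (x + K); set F0 := F (e * x).
  have F1le : F1 <= th * F x by exact: H1.
  have F2ge : th^-1 * F x <= F2.
    apply: (le_trans (H2 _ xx2)); apply: tail_ni => //.
    by rewrite mulrDl mul1r lerD2l mulrC -ler_pdivrMr.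
  have F2le : F2 <= F x by apply: tail_ni => //; rewrite lerDl ltW.
  have F0le : F0 <= La * F x by exact: H3.
  have F0le' : K * F0 <= dl / 2.
    have : F0 <= dl / (2 * K).
      by apply: le_trans H4; apply: tail_ni => //; rewrite mulrC -ler_pdivrMr.
    by rewrite ler_pdivlMr ?mulr_gt0//; lra.
  have Fx0 := regvar_gt0 mX rvX x.
  have mI := measurable_gt mX (e * x).
  pose g w := (1 + C * (K * F2)) * \1_[set w | e * x < X w] w +
              C * (G x + F1 * X w - F2 * A w).
  have ig1 := itg_Z (1 + C * (K * F2)) (itg_indic P mI).
  have ig3 : itg (fun w => G x + F1 * X w).
    by apply: (itg_D (itg_cst P (G x))); exact: itg_Z.
  have ig4 : itg (fun w => F2 * A w) by exact: itg_Z.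
  have ig2 := itg_Z C (itg_B ig3 ig4).
  have ig : itg g by exact: itg_D ig1 ig2.
  have Eg : 'E g = (1 + C * (K * F2)) * F0 + C * (G x + F1 * b - F2 * m).
    rewrite (Ex_D ig1 ig2) Ex_Z ?Ex_indic//; last exact: itg_indic.
    rewrite (Ex_Z C (itg_B ig3 ig4)) (Ex_B ig3 ig4) (Ex_D (itg_cst P _)); last exact: itg_Z.
    by rewrite Ex_cst !Ex_Z.
  (* On a long service, [V <= 1] and [C * K * F2] makes [g] at least 1. *)
  apply: (@le_trans _ _ ('E g)).
    apply: Ex_le => // w; rewrite /g indicE.
    have [Aw AK] := andP (A0K w).
    have F20 : 0 <= F2 by exact: tail_ge0.
    have F10 : 0 <= F1 by exact: tail_ge0.
    have AF : F2 * A w <= K * F2 by rewrite mulrC ler_wpM2r.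
    have XF : 0 <= F1 * X w by rewrite mulr_ge0.
    case: (boolP (w \in _)) => /=.
      rewrite inE/= => _; rewrite mulr1 (le_trans (V1 _))//.
      rewrite -addrA lerDl -mulrDr; apply: mulr_ge0; first exact: ltW.
      by have := excess_ge0 P X x; lra.
    rewrite notin_setE/= => /negP; rewrite -leNgt => Xx.
    rewrite mulr0 add0r /V ge_min ler_pM2l//; apply/orP; right.
    by apply: excess_step; [rewrite X_ge0 Xx|exact: A0K].
  rewrite Eg.
  apply: (@drift_arith th dl (F x) _ _ _ b m La) => //; try exact: tail_ge0.
  - exact: ltW.
  - exact: ltW.
  - by rewrite -ler_pdivrMr.
pose t := tail P M.
have mt : measurable_fun setT t by exact: measurable_tail.
have it x : itg (fun w => t (x - Z w)).
  apply: (itg_bnd P (c := 1)) => [|w]; first exact: measurableT_comp.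
  by rewrite ger0_norm ?tail_ge0// tail_le1.
have mf : measurable_fun setT (fun x => t x - V x) by exact: measurable_funB.
have iY : itg (fun w => A w - X w) by exact: itg_B.
have ZE : (fun w => - Z w) = (fun w => A w - X w).
  by apply/funext => w; rewrite /Z opprB.
have ypos : 0 < (m - b) / 2 by rewrite divr_gt0// subr_gt0.
have : forall x, t x - V x <= 0.
  apply: (@maximum_principle _ _ _ P (fun w => - Z w) _ t ((m - b) / 2) 1 x0) => //.
  - exact: measurable_funN.
  - by move=> x; rewrite gerBl.
  - exact: tail_ni.
  - exact: tail_vanish.
  - by move=> x; rewrite lerBlDr (le_trans (tail_le1 P mM x))// lerDl.
  - apply: (pr_ge_gt0 (K := K)); rewrite ?ZE//.
    + by move=> w; have := X_ge0 w; have /andP[] := A0K w; rewrite /Z; lra.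
    + by rewrite Ex_B// -/m -/b; have : 0 < m - b; [rewrite subr_gt0|lra].
  move=> x fx.
  have CG1 : C * G x < 1.
    move: fx; rewrite subr_gt0 /V => h; have := lt_le_trans h (tail_le1 P mM x).
    by rewrite gt_min ltxx.
  have xx0 : x0 <= x.
    rewrite leNgt; apply/negP => /ltW /(excess_ni iX) h.
    by move: CG1; rewrite ltNge (le_trans C2)// ler_pM2l.
  split => //.
  have Vx : V x = C * G x by rewrite /V min_r// ltW.
  have x_ge0 : 0 <= x by rewrite (le_trans Ke0)// (le_trans _ xx0)// le_max lexx orbT.
  rewrite lerBlDr Vx (le_trans (stat _ x_ge0))// (indep_add_tail _ mM mZ ind).
  have ip : itg (fun w => Num.max 0 (t (x - Z w) - V (x - Z w))).
    apply: (itg_bnd P (c := 1)) => [|w].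
      by apply: measurable_maxr => //; apply: measurable_funB; exact: measurableT_comp.
    rewrite ger0_norm ?le_max ?lexx// ge_max ler01/= lerBlDr.
    by rewrite (le_trans (tail_le1 P mM _))// lerDl.
  apply: (le_trans _ (lerD (lexx _) (super x xx0))).
  rewrite -Ex_D//; apply: Ex_le => //; first exact: itg_D.
  by move=> w; rewrite -lerBlDr le_max lexx orbT.
move=> tV; exists C => // x.
by have := tV x; rewrite subr_le0 le_min => /andP[].
Qed.

(** The hypothesis says that [tail P H] is a supersolution of a renewal
    equation with source term of order [F]. The function [c * G] is a
    subsolution, as it decreases by at most [c * F x * 'E A] over one step. *)
Lemma excess_le_tail (H A : T -> R) (K q x1 dl : R) :
    measurable_fun setT H -> itg A -> (forall w, 0 <= A w) -> 0 < 'E A ->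
    0 < dl -> 0 < pr [set w | dl <= A w] -> 0 < q ->
    (forall x, x1 <= x ->
      'E (fun w => tail P H (x + A w)) + q * F (x + K) <= tail P H x) ->
  exists c x0, 0 < c /\ forall x, x0 <= x -> c * G x <= tail P H x.
Proof.
move=> mH iA A0 EA0 dl0 pA q0 sub.
have mA : measurable_fun setT A by exact: itg_measurable iA.
have [e /andP[e0 _] [_ ge1]] := powR_near1 r (ltr1n _ 2 : 1 < 2 :> R).
have e20 : 0 < 1 + e by rewrite ltr_wpDl// ltW.
have [x2 H2] := regvar_ge mX rvX e20 ge1.
pose x0 := Num.max x1 (Num.max x2 (K / e)).
pose c := q / (2 * 'E A).
have c0 : 0 < c by rewrite divr_gt0// mulr_gt0.
have cE : c * 'E A = q / 2 by rewrite /c; field; rewrite gt_eqF.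
pose h := tail P H.
have mh : measurable_fun setT h by exact: measurable_tail.
have mG : measurable_fun setT G.
  by apply: nonincreasing_measurable => // x y; exact: excess_ni.
have mcG : measurable_fun setT (fun x => c * G x) by exact: measurable_funM.
pose f x := if x0 <= x then c * G x - h x else 0.
have mf : measurable_fun setT f.
  apply: measurable_fun_ifT => //; last exact: measurable_funB.
  exact: measurable_fun_ler.
have fG x : f x <= c * G x.
  have cG : 0 <= c * G x by rewrite mulr_ge0 ?excess_ge0// ltW.
  by rewrite /f; case: ifP => // _; rewrite gerBl tail_ge0.
have fG0 x : f x <= c * G x0.
  have cG : 0 <= c * G x0 by rewrite mulr_ge0 ?excess_ge0// ltW.
  have := fG x; rewrite /f; case: ifP => // x0x /le_trans; apply.
  by rewrite ler_pM2l// (excess_ni iX).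
have f0 : forall x, f x <= 0.
  apply: (@maximum_principle _ _ _ P A f (fun x => c * G x) dl (c * G x0) x0) => //.
  - by move=> x y xy; rewrite ler_pM2l// (excess_ni iX).
  - move=> eps eps0.
    have [x Gx] := excess_vanish iX X_ge0 (divr_gt0 eps0 c0).
    by exists x; rewrite mulrC -ler_pdivlMr.
  move=> x; rewrite {1 2}/f; case: (leP x0 x) => [x0x _|]; last by rewrite ltxx.
  split => //; move: (x0x); rewrite !ge_max => /and3P[xx1 xx2 xK].
  have iG : itg (fun w => c * G (x + A w)).
    apply: itg_Z; apply: (itg_bnd P (c := G x)) => [|w].
      by apply: measurableT_comp => //; exact: measurable_funD.
    by rewrite ger0_norm ?excess_ge0// (excess_ni iX)// lerDl.
  have ih : itg (fun w => h (x + A w)).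
    apply: (itg_bnd P (c := 1)) => [|w].
      by apply: measurableT_comp => //; exact: measurable_funD.
    by rewrite ger0_norm ?tail_ge0// tail_le1.
  have iGA : itg (fun w => c * G x + - (c * F x) * A w).
    by apply: (itg_D (itg_cst P (c * G x))); exact: itg_Z.
  have drop : c * G x - c * F x * 'E A <= 'E (fun w => c * G (x + A w)).
    have -> : c * G x - c * F x * 'E A = 'E (fun w => c * G x + - (c * F x) * A w).
      rewrite (Ex_D (itg_cst P (c * G x)) (itg_Z (- (c * F x)) iA)) Ex_cst.
      by rewrite Ex_Z// mulNr.
    apply: Ex_le => // w.
    have xA : x <= x + A w by rewrite lerDl.
    have := ler_wpM2l (ltW c0) (excess_diff_le iX xA).
    by rewrite addrAC subrr add0r; lra.
  have Fx : F x <= 2 * F (x + K).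
    rewrite -ler_pdivrMl// (le_trans (H2 _ xx2))// tail_ni//.
    by rewrite mulrDl mul1r lerD2l mulrC -ler_pdivrMr.
  have : 'E (fun w => c * G (x + A w)) - 'E (fun w => h (x + A w)) <=
         'E (fun w => Num.max 0 (f (x + A w))).
    rewrite -Ex_B//; apply: Ex_le; [exact: itg_B| |].
      apply: (itg_bnd P (c := c * G x0)) => [|w].
        apply: measurable_maxr => //; apply: measurableT_comp => //.
        exact: measurable_funD.
      rewrite ger0_norm ?le_max ?lexx// ge_max fG0 andbT.
      by rewrite mulr_ge0 ?excess_ge0// ltW.
    by move=> w; rewrite /f ifT ?le_max ?lexx ?orbT// (le_trans x0x)// lerDl.
  have := sub x xx1; rewrite -/h.
  have : c * F x * 'E A <= q * F (x + K).
    rewrite mulrAC cE; have : q / 2 * F x <= q / 2 * (2 * F (x + K)).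
      by rewrite ler_wpM2l// divr_ge0// ltW.
    lra.
  lra.
exists c, x0; split => // x x0x.
by have := f0 x; rewrite /f x0x subr_le0.
Qed.

End TailComparison.

(** * O-regular variation by comparison *)

Section ORegularVariation.
Context d (T : measurableType d) (R : realType) (P : probability T R).
Notation itg f := (P.-integrable setT (EFin \o f)).

Lemma limf_esup_le (f : R -> R) (K M : R) : (forall x, M < x -> f x <= K) ->
  (limf_esup (fun x => (f x)%:E) +oo%R <= K%:E)%E.
Proof.
move=> fK; apply: (@le_trans _ _ (ereal_sup ((fun x => (f x)%:E) @` [set x | M < x]))).
  apply: ereal_inf_lbound; exists [set x | M < x] => //.
  by exists M; split; rewrite ?num_real.
by apply: ge_ereal_sup => _ [x /= Mx <-]; rewrite lee_fin fK.
Qed.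

Lemma limf_einf_ge (f : R -> R) (K M : R) : (forall x, M < x -> K <= f x) ->
  (K%:E <= limf_einf (fun x => (f x)%:E) +oo%R)%E.
Proof.
move=> fK; rewrite /limf_einf leeNr -EFinN.
apply: (@limf_esup_le (fun x => - f x) _ M) => x /fK.
by rewrite lerN2.
Qed.

Lemma o_regvar_sandwich (X Y : T -> R) (r c C x0 : R) :
    itg X -> (forall w, 0 <= X w) -> regularly_varying P X r ->
    0 < c -> 0 < C ->
    (forall x, x0 <= x -> c * excess P X x <= tail P Y x <= C * excess P X x) ->
  O_regularly_varying P Y (1 + r).
Proof.
move=> iX X0 rvX c0 C0 YX; set G := excess P X in YX.
have mX : measurable_fun setT X by exact: itg_measurable iX.
have G0 x : 0 < G x by exact: (excess_gt0 iX rvX).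
exists (c / (3 * C)), (3 * C / c).
have c10 : 0 < c / (3 * C) by rewrite divr_gt0// mulr_gt0.
have c20 : 0 < 3 * C / c by rewrite divr_gt0// mulr_gt0.
split => // a a1 ratio.
have a0 : 0 < a by rewrite (lt_le_trans ltr01).
have ar0 : 0 < a `^ r by rewrite powR_gt0.
have aE : a `^ (1 + r) = a * a `^ r.
  rewrite powRD; first by rewrite powRr1// ltW.
  by rewrite (gt_eqF a0) implybT.
have p0 : 0 < a * a `^ r by rewrite mulr_gt0.
have [x1 H1] : exists x1, forall x, x1 <= x ->
    tail P X (a * x) <= 2 * a `^ r * tail P X x.
  by apply: (regvar_le mX rvX) => //; lra.
have [x2 H2] : exists x2, forall x, x2 <= x ->
    2^-1 * a `^ r * tail P X x <= tail P X (a * x).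
  by apply: (regvar_ge mX rvX) => //; lra.
pose M := Num.max (Num.max 0 x0) (Num.max x1 x2).
have Mx x : M < x -> [/\ 0 <= x, x0 <= x, x0 <= a * x &
   2^-1 * (a * a `^ r) * G x <= G (a * x) <= 2 * (a * a `^ r) * G x].
  move=> /ltW; rewrite !ge_max => /andP[/andP[x_0 xx0] /andP[xx1 xx2]].
  have xax : x <= a * x by rewrite ler_peMl.
  split => //; first exact: le_trans xax.
  rewrite !(mulrCA _ a); apply/andP; split.
    apply: (excess_scale_ge iX) => //; first by rewrite mulr_gt0// invr_gt0.
    by move=> y xy; apply: H2; exact: le_trans xy.
  apply: (excess_scale_le iX) => //; first by rewrite mulr_ge0// ltW.
  by move=> y xy; apply: H1; exact: le_trans xy.
rewrite aE; split.
  apply: (@lt_le_trans _ _ (c / (2 * C) * (a * a `^ r))%:E).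
    rewrite lte_fin ltr_pM2r// !invfM ltr_pM2l// ltr_pM2r ?invr_gt0//.
    by rewrite ltf_pV2 ?posrE// ltr_nat.
  apply: (@limf_einf_ge _ _ M) => x /Mx[x_0 xx0 xax /andP[Gl _]].
  have /andP[Yl Yu] := YX _ xx0; have /andP[Yl' _] := YX _ xax.
  have Y0 : 0 < tail P Y x by apply: lt_le_trans Yl; rewrite mulr_gt0.
  rewrite ler_pdivlMr// (le_trans _ Yl')//.
  apply: (@le_trans _ _ (c * (2^-1 * (a * a `^ r) * G x))); last by rewrite ler_pM2l.
  have -> : c * (2^-1 * (a * a `^ r) * G x) = c / (2 * C) * (a * a `^ r) * (C * G x).
    by field; rewrite gt_eqF.
  by rewrite ler_wpM2l// ltW// mulr_gt0// divr_gt0// mulr_gt0.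
apply: (@le_lt_trans _ _ (2 * C / c * (a * a `^ r))%:E); last first.
  by rewrite lte_fin ltr_pM2r// ltr_pM2r ?invr_gt0// ltr_pM2r// ltr_nat.
apply: (@limf_esup_le _ _ M) => x /Mx[x_0 xx0 xax /andP[_ Gu]].
have /andP[Yl Yu] := YX _ xx0; have /andP[_ Yu'] := YX _ xax.
have Y0 : 0 < tail P Y x by apply: lt_le_trans Yl; rewrite mulr_gt0.
rewrite ler_pdivrMr// (le_trans Yu')//.
apply: (@le_trans _ _ (C * (2 * (a * a `^ r) * G x))); first by rewrite ler_pM2l.
have -> : C * (2 * (a * a `^ r) * G x) = 2 * C / c * (a * a `^ r) * (c * G x).
  by field; rewrite gt_eqF.
by rewrite ler_wpM2l// ltW// mulr_gt0// divr_gt0// mulr_gt0.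
Qed.

End ORegularVariation.

(** * The fork-join model *)

Section Model.
Context d (T : measurableType d) (R : realType) (P : probability T R).
Context (N nF nJ : nat).
Context (A : nat -> {RV P >-> R}) (B : nat -> {RV P >-> nF.-tuple R}).
Context (S : nat -> T -> {ffun 'I_nF -> 'I_N}) (V0 : {RV P >-> N.-tuple R}).
Hypothesis nJF : (1 <= nJ <= nF)%N.
Hypothesis nFN : (nF <= N)%N.
Hypothesis hm : coc_model A B S V0.
Notation pr A := (fine (P A)).
Notation "''E' f" := (Rintegral P setT f) (at level 10, f at level 8).
Notation itg f := (P.-integrable setT (EFin \o f)).
Notation V := (workload nJ A B S V0).

Lemma measurable_workload n : measurable_fun setT (V n).
Proof.
elim: n => [|n IH]; first exact: measurable_funPT.
apply: (measurable_finite_choice (s := S n)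
  (g := fun s w => next_workload nJ (V n w) s (B n w) (A n w))).
  by move=> f; exact: (coc_S_meas hm).
by move=> f; apply: measurable_next_workload => //; exact: measurable_funPT.
Qed.

Section Events.
Local Open Scope ereal_scope.
Variables (CV : set (N.-tuple R)) (CA : nat -> set R).
Variables (CB : nat -> set (nF.-tuple R)) (CS : nat -> set {ffun 'I_nF -> 'I_N}).

Definition source_event (i : source) : set T :=
  match i with
  | Initial => V0 @^-1` CV
  | Interarrival n => A n @^-1` CA n
  | Sizes n => B n @^-1` CB n
  | Servers n => S n @^-1` CS n
  end.

Lemma indep_sources (l : seq source) :
    measurable CV -> (forall n, measurable (CA n)) ->
    (forall n, measurable (CB n)) -> uniq l ->
  P (\big[setI/setT]_(i <- l) source_event i) = \prod_(i <- l) P (source_event i).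
Proof.
move=> mV mA mB lu; pose J := seq_fset tt l.
have JE : perm_eq J l by apply: uniq_perm => // i; rewrite seq_fsetE.
have ev i : i \in J -> source_events A B S V0 i (source_event i).
  move=> _; case: i => [|n|n|n] /=.
  - by exists CV; rewrite ?setTI.
  - by exists (CA n); rewrite ?setTI.
  - by exists (CB n); rewrite ?setTI.
  - by exists (CS n); rewrite ?setTI.
have := coc_indep hm ev; rewrite (perm_big _ JE)/= => <-.
have -> : [set` J] = [set` l].
  by apply/seteqP; split => i /=; rewrite seq_fsetE.
by rewrite bigcap_seq.
Qed.

End Events.

Let X := size_stat nJ B 0.

Let mX : measurable_fun setT X.
Proof. by apply: measurable_ordstat => //; exact: measurable_funPT. Qed.

Let X_ge0 w : 0 <= X w.
Proof. by apply: ordstat_ge_lb => // i; exact: (coc_B_ge0 hm). Qed.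

Lemma itg_interarrival : itg (A 0).
Proof.
have /andP[_ Ay] := coc_A_mean hm.
apply/integrableP; split; first by apply/measurable_EFinP; exact: measurable_funPT.
move: Ay; rewrite unlock; congr (_ < _)%E; apply: eq_integral => w _ /=.
by rewrite ger0_norm// (coc_A_ge0 hm).
Qed.

Lemma mean_interarrival_gt0 : 0 < 'E (A 0).
Proof.
have /andP[A0 Ay] := coc_A_mean hm; move: A0 Ay; rewrite unlock => A0 Ay.
by apply: fine_gt0; rewrite A0 Ay.
Qed.

Hypothesis hrho : (rho_U nJ A B < 1)%E.

(** [rho_U] is a quotient of extended reals; being below 1 it forces the mean
    size to be finite. *)
Lemma size_subcritical : itg X /\ 'E X < 'E (A 0).
Proof.
have /andP[A0 Ay] := coc_A_mean hm.
have AE : ('E_P[A 0] = ('E (A 0))%:E)%E.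
  by rewrite unlock /Rintegral fineK// integrable_fin_num// itg_interarrival.
have EA0 := mean_interarrival_gt0.
have X0 : (0 <= 'E_P[X])%E by exact: expectation_ge0.
have XA : ('E_P[X] < ('E (A 0))%:E)%E.
  move: hrho; rewrite /rho_U -/X AE inver gt_eqF//.
  by rewrite lte_pdivrMr// mul1e.
have iX : itg X.
  apply/integrableP; split; first by apply/measurable_EFinP.
  have := lt_trans XA (ltry _); rewrite unlock; congr (_ < _)%E.
  by apply: eq_integral => w _ /=; rewrite ger0_norm.
split => //; rewrite -lte_fin; apply: le_lt_trans XA.
by rewrite unlock /Rintegral fineK// integrable_fin_num.
Qed.

Hypothesis hs : steady_state nJ A B S V0.

Lemma stationary_tail (g : N.-tuple R -> R) n : measurable_fun setT g ->
  tail P (g \o V n) = tail P (g \o V0).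
Proof.
move=> mg; apply/funext => x; congr fine.
have mC : measurable [set v | x < g v] by exact: measurable_gt.
exact: (hs n mC).
Qed.

(** The peak workload found by job 1 has the law of the one found by job 0 and
    is at most one Lindley step away from it. Capping the interarrival time at
    a large [K] only increases the bound and keeps the drift negative. *)
Lemma peak_tail_le (r : R) : regularly_varying P X r ->
  exists2 C, 0 < C & forall x, tail P (@peak _ _ \o V0) x <= C * excess P X x.
Proof.
move=> rvX; have [iX XA] := size_subcritical.
have iA := itg_interarrival; have A_ge0 := coc_A_ge0 hm 0.
have d0 : 0 < ('E (A 0) - 'E X) / 2 by rewrite divr_gt0// subr_gt0.
have [K K0 HK] := Ex_minK iA A_ge0 d0.
have mA : measurable_fun setT (A 0) by exact: measurable_funPT.
have mA' : measurable_fun setT (fun w => Num.min (A 0 w) K) by exact: measurable_minr.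
have mV : measurable_fun setT V0 by exact: measurable_funPT.
have mM : measurable_fun setT (@peak _ _ \o V0) by exact: measurable_peak.
apply: (@queue_tail_le _ _ _ P X r iX X_ge0 rvX _ (fun w => Num.min (A 0 w) K) K) => //.
- by move=> w; rewrite le_min A_ge0 ge_min lexx orbT ltW.
- by move: HK; have : 0 < 'E (A 0) - 'E X; [rewrite subr_gt0|lra].
- move=> E D mE mD.
  pose g (z : R * nF.-tuple R) := ordstat nJ z.2 - Num.min z.1 K.
  have mg : measurable_fun setT g.
    by apply: measurable_funB; [exact: measurable_ordstat|exact: measurable_minr].
  have mgD : measurable (g @^-1` D) by rewrite -[X in measurable X]setTI; exact: mg.
  have mpE : measurable (@peak R N @^-1` E).
    by rewrite -[X in measurable X]setTI; exact: measurable_peak.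
  apply: (@indep_pair _ _ _ P _ _ _ _ (V0 @^-1` (@peak R N @^-1` E)) (A 0) (B 0) _ _ _ _ _ mgD) => //.
  + by rewrite -[X in measurable X]setTI; exact: mV.
  + move=> E' F' mE' mF'.
    have h3 := @indep_sources (@peak R N @^-1` E) (fun=> E') (fun=> F') (fun=> setT)
      [:: Initial; Interarrival 0; Sizes 0] mpE (fun=> mE') (fun=> mF') isT.
    have h2 := @indep_sources (@peak R N @^-1` E) (fun=> E') (fun=> F') (fun=> setT)
      [:: Interarrival 0; Sizes 0] mpE (fun=> mE') (fun=> mF') isT.
    move: h3 h2; rewrite !big_cons !big_nil !setIT !mule1/= => h3 h2.
    by rewrite h3 h2.
move=> x x0; rewrite -(stationary_tail 1); last exact: measurable_peak.
apply: pr_le.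
- by apply: measurable_gt; apply: measurable_peak; exact: (measurable_workload 1).
- by apply: measurable_gt; apply: measurable_funD => //; exact: measurable_funB.
move=> w /= xV; have := lt_le_trans xV (peak_next nJF _ _ _ (coc_B_ge0 hm 0 ^~ w)).
rewrite lt_max ltNge x0/= => /lt_le_trans; apply.
by rewrite -addrA lerD2l lerD2l lerN2 ge_min lexx.
Qed.

(* Any fixed set of [nF] servers would do. *)
Let s0 : {ffun 'I_nF -> 'I_N} := [ffun i => widen_ord nFN i].

Let s0_inj : injective s0.
Proof. by move=> i j; rewrite !ffunE => /(congr1 val)/= /val_inj. Qed.

Let pS n : 0 < pr (S n @^-1` [set s0]).
Proof.
rewrite (coc_S_unif hm _ s0_inj)/= invr_gt0 ltr0n.
by rewrite ffact_gt0.
Qed.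

Let H v : R := ordstat nJ (waits v s0).

Let mH : measurable_fun setT H.
Proof. by apply: measurable_ordstat => //; exact: measurable_waits. Qed.

Lemma interarrival_bound : exists2 K, 0 < K &
  forall i, 2^-1 <= pr [set w | A i w <= K].
Proof.
have [K1 HK1] : exists K, tail P (A 0) K <= 2^-1.
  by apply: tail_vanish; [exact: measurable_funPT|rewrite invr_gt0].
exists (Num.max K1 1) => [|i]; first by rewrite lt_max ltr01 orbT.
have mK : measurable [set a : R | a <= Num.max K1 1] by exact: measurable_le_set.
rewrite [P _](coc_A_law hm i mK) (@pr_le_tailE _ _ _ P (A 0)); last exact: measurable_funPT.
have : tail P (A 0) (Num.max K1 1) <= tail P (A 0) K1.
  by apply: tail_ni; [exact: measurable_funPT|rewrite le_max lexx].
by lra.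
Qed.

(** Job 1 finds [H] above [x] if either [H] was above [x + A 0] at job 0, or
    [H] was at most [x1] and job 0 went to the servers [s0] with a size above
    [x + K] and was followed by an interarrival time of at most [K]. For
    [x >= x1] these events are disjoint, and the second has probability at
    least [q * F (x + K)]. *)
Lemma fixed_wait_tail_ge (r : R) : regularly_varying P X r ->
  exists c x0, 0 < c /\
    forall x, x0 <= x -> c * excess P X x <= tail P (H \o V0) x.
Proof.
move=> rvX; have [iX XA] := size_subcritical.
have iA := itg_interarrival; have A_ge0 := coc_A_ge0 hm 0.
have EA0 := mean_interarrival_gt0.
have mA : measurable_fun setT (A 0) by exact: measurable_funPT.
have mV : measurable_fun setT V0 by exact: measurable_funPT.
have mHV : measurable_fun setT (H \o V0) by exact: measurableT_comp.
have [dl dl0 pA] : exists2 dl, 0 < dl & 0 < pr [set w | dl <= A 0 w].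
  have d0 : 0 < 'E (A 0) / 2 by rewrite divr_gt0.
  have [K K0 HK] := Ex_minK iA A_ge0 d0.
  exists ('E (A 0) / 4); first by rewrite divr_gt0.
  have mA' : measurable_fun setT (fun w => Num.min (A 0 w) K) by exact: measurable_minr.
  have p' : 0 < pr [set w | 'E (A 0) / 4 <= Num.min (A 0 w) K].
    apply: (pr_ge_gt0 (K := K)).
    - apply: itg_dom iA => // w; rewrite ger0_norm ?ge_min ?lexx//.
      by rewrite le_min A_ge0 ltW.
    - by move=> w; rewrite ge_min lexx orbT.
    - by lra.
  apply: (lt_le_trans p'); apply: pr_le; try exact: measurable_le_set.
  by move=> w /=; rewrite le_min => /andP[].
have [K K0 pK] := interarrival_bound.
have [x1 H1] : exists x1, tail P (H \o V0) x1 <= 2^-1.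
  by apply: tail_vanish => //; rewrite invr_gt0.
pose q := 2^-1 * 2^-1 * pr (S 0 @^-1` [set s0]).
have q0 : 0 < q by rewrite !mulr_gt0 ?invr_gt0.
apply: (@excess_le_tail _ _ _ P X r iX X_ge0 rvX _ (A 0) K q x1 dl) => //.
move=> x xx1.
pose D1 := [set w | x < H (V0 w) + - A 0 w].
pose D2 := V0 @^-1` [set v | H v <= x1] `&` (A 0 @^-1` [set a | a <= K] `&`
  (B 0 @^-1` [set b | x + K < ordstat nJ b] `&` (S 0 @^-1` [set s0]))).
have mD1 : measurable D1.
  by apply: measurable_lt_set => //; apply: measurable_funD => //; exact: measurable_funN.
have mHx : measurable [set v : N.-tuple R | H v <= x1] by exact: measurable_le_set.
have mK : measurable [set a : R | a <= K] by exact: measurable_le_set.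
have mBx : measurable [set b : nF.-tuple R | x + K < ordstat nJ b].
  by apply: measurable_gt; exact: measurable_ordstat.
have mD2 : measurable D2.
  apply: measurableI; first by rewrite -[X in measurable X]setTI; exact: mV.
  apply: measurableI; first by rewrite -[X in measurable X]setTI; exact: mA.
  apply: measurableI; last exact: (coc_S_meas hm).
  by rewrite -[X in measurable X]setTI; exact: (measurable_funPT (B 0)).
have D12 : [disjoint D1 & D2].
  apply/disj_set2P/seteqP; split => // w [] /= xH [Hx _].
  suff : x < x by rewrite ltxx.
  by have := A_ge0 w; move: xH Hx; rewrite /D1/=; lra.
have : pr (D1 `|` D2) <= tail P (H \o V0) x.
  rewrite -(stationary_tail 1 mH); apply: pr_le.
  - exact: measurableU.
  - by apply: measurable_gt; apply: measurableT_comp => //; exact: (measurable_workload 1).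
  move=> w /= [xH|[Hx [AK [Bx Sw]]]].
    apply: (lt_le_trans xH); rewrite lerBlDr.
    exact: (waits_drain nJF (V0 w) (S 0 w) (B 0 w) (A 0 w) s0).
  have := waits_next_ge_size nJF s0 (B 0 w) (A 0 w) (coc_V0_ge0 hm ^~ w).
  by rewrite /H Sw; move: AK Bx; rewrite /=; lra.
rewrite pr_U//; apply: le_trans; apply: lerD.
  have -> : pr D1 = tail P (fun w => (H \o V0) w + - A 0 w) x by [].
  rewrite indep_add_tail//; [|exact: measurable_funN|].
    apply: Ex_le; last by move=> w; rewrite opprK.
      apply: (itg_bnd P (c := 1)) => [|w].
        by apply: measurableT_comp; [exact: measurable_tail|exact: measurable_funD].
      by rewrite ger0_norm ?tail_ge0// tail_le1.
    apply: (itg_bnd P (c := 1)) => [|w].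
      apply: measurableT_comp; [exact: measurable_tail|].
      by apply: measurable_funB => //; exact: measurable_funN.
    by rewrite ger0_norm ?tail_ge0// tail_le1.
  move=> E F mE mF.
  have mHE : measurable (H @^-1` E) by rewrite -[X in measurable X]setTI; exact: mH.
  have mNF : measurable ((fun a : R => - a) @^-1` F).
    by rewrite -[X in measurable X]setTI; have := oppr_measurable (D := [set: R]); apply.
  have := @indep_sources (H @^-1` E) (fun=> (fun a : R => - a) @^-1` F)
    (fun=> setT) (fun=> setT)
    [:: Initial; Interarrival 0] mHE (fun=> mNF) (fun=> measurableT) isT.
  by rewrite !big_cons !big_nil !setIT !mule1/=.
have := @indep_sources [set v | H v <= x1] (fun=> [set a | a <= K])
    (fun=> [set b | x + K < ordstat nJ b]) (fun=> [set s0])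
    [:: Initial; Interarrival 0; Sizes 0; Servers 0] mHx (fun=> mK) (fun=> mBx) isT.
rewrite !big_cons !big_nil !setIT !mule1/= -/D2 => D2E.
have mV1 : measurable (V0 @^-1` [set v | H v <= x1]).
  by rewrite -[X in measurable X]setTI; exact: mV.
have mA1 : measurable (A 0 @^-1` [set a | a <= K]).
  by rewrite -[X in measurable X]setTI; exact: mA.
have mB1 : measurable (B 0 @^-1` [set b | x + K < ordstat nJ b]).
  by rewrite -[X in measurable X]setTI; exact: (measurable_funPT (B 0)).
have mS1 := coc_S_meas hm 0 s0.
rewrite D2E -(fineK (pr_fin P mV1)) -(fineK (pr_fin P mA1)) -(fineK (pr_fin P mB1)).
rewrite -(fineK (pr_fin P mS1)) -!EFinM /=.
have h1 : 2^-1 <= pr (V0 @^-1` [set v | H v <= x1]).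
  have := @pr_le_tailE _ _ _ P (H \o V0) x1 mHV; rewrite /= => ->; lra.
have h2 : 2^-1 <= pr (A 0 @^-1` [set a | a <= K]) by exact: pK.
have -> : q * tail P X (x + K) = 2^-1 * (2^-1 *
    (tail P X (x + K) * pr (S 0 @^-1` [set s0]))) by rewrite /q; ring.
have t0 : 0 <= tail P X (x + K) * pr (S 0 @^-1` [set s0]).
  by rewrite mulr_ge0 ?tail_ge0// ltW.
apply: ler_pM => //; first by rewrite mulr_ge0.
exact: ler_wpM2r.
Qed.

Lemma fixed_wait_drain n w : H (V0 w) - \sum_(i < n) A i w <= H (V n w).
Proof.
elim: n => [|n IH]; first by rewrite big_ord0 subr0.
have := waits_drain nJF (V n w) (S n w) (B n w) (A n w) s0.
by rewrite big_ord_recr /= -/(H _) -/(H (V n w)); move: IH; rewrite -/(H _); lra.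
Qed.

Lemma measurable_wait_stat n : measurable_fun setT (wait_stat nJ A B S V0 n).
Proof.
apply: (measurable_finite_choice (s := S n)
  (g := fun s w => ordstat nJ (waits (V n w) s))).
  by move=> f; exact: (coc_S_meas hm).
move=> f; apply: measurable_ordstat => //; apply: measurable_waits.
exact: measurable_workload.
Qed.

Lemma measurable_response_time n : measurable_fun setT (response_time nJ A B S V0 n).
Proof.
apply: (measurable_finite_choice (s := S n)
  (g := fun s w => response nJ (V n w) s (B n w))).
  by move=> f; exact: (coc_S_meas hm).
by move=> f; apply: measurable_response => //; exact: measurable_workload.
Qed.

(** Job [n] waits more than [x] if [H] exceeds [x + n K] at job 0, the first
    [n] interarrival times are at most [K], and job [n] is sent to [s0]. These
    events come from distinct sources, hence are independent. *)
Lemma wait_tail_ge (r : R) n : regularly_varying P X r ->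
  exists c x0, 0 < c /\
    forall x, x0 <= x -> c * excess P X x <= tail P (wait_stat nJ A B S V0 n) x.
Proof.
move=> rvX; have [iX XA] := size_subcritical.
have [c [x0 [c0 Hc]]] := fixed_wait_tail_ge rvX.
have [K K0 pK] := interarrival_bound.
have t20 : 0 < 2 `^ r :> R by rewrite powR_gt0.
have [x1 H1] : exists x1, forall x, x1 <= x ->
    2 `^ r / 2 * tail P X x <= tail P X (2 * x).
  by apply: (regvar_ge mX rvX) => //; lra.
have mAK (i : nat) : measurable [set a : R | a <= K] by exact: measurable_le_set.
pose l := [seq Interarrival i | i <- iota 0 n].
pose CA (i : nat) := [set a : R | a <= K].
pose p := \prod_(i <- l) pr (source_event setT CA (fun=> setT) (fun=> [set s0]) i).
have p0 : 0 < p.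
  rewrite /p /l big_map; apply: prodr_gt0 => k _.
  by apply: lt_le_trans (pK k); rewrite invr_gt0.
have nK0 : 0 <= n%:R * K by rewrite mulr_ge0 ?ler0n// ltW.
pose x2 := Num.max (Num.max x0 x1) (n%:R * K).
exists (c * (2 * (2 `^ r / 2)) * (pr (S n @^-1` [set s0]) * p)), x2; split.
  by rewrite !mulr_gt0// divr_gt0.
move=> x; rewrite !ge_max => /andP[/andP[xx0 xx1] xK].
pose D := \big[setI/setT]_(i <- Initial :: Servers n :: l)
  source_event [set v | x + n%:R * K < H v] CA (fun=> setT) (fun=> [set s0]) i.
have mCV : measurable [set v : N.-tuple R | x + n%:R * K < H v] by exact: measurable_gt.
have mE i : measurable (source_event [set v | x + n%:R * K < H v] CA (fun=> setT)
    (fun=> [set s0]) i).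
  case: i => [|i|i|i] /=; last exact: (coc_S_meas hm).
  - by rewrite -[X in measurable X]setTI; exact: (measurable_funPT V0).
  - by rewrite -[X in measurable X]setTI; exact: (measurable_funPT (A i) measurableT _ (mAK i)).
  - by rewrite preimage_setT.
have ul : uniq (Initial :: Servers n :: l).
  have ul : uniq l by rewrite map_inj_uniq ?iota_uniq// => i j [].
  rewrite !cons_uniq ul andbT.
  apply/andP; split; last by apply/negP => /mapP[k _].
  by apply/negP; rewrite inE => /predU1P[//|/mapP[k _]].
have mD : measurable D by apply: bigsetI_measurable => i _; exact: mE.
have PD : pr D = tail P (H \o V0) (x + n%:R * K) * (pr (S n @^-1` [set s0]) * p).
  rewrite /D indep_sources// prod_pr// !big_cons /=; congr (_ * (_ * _)).
  by rewrite /p /l !big_map.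
have DW : D `<=` [set w | x < wait_stat nJ A B S V0 n w].
  move=> w; rewrite /D -bigcap_seq => Dw /=.
  have HV : x + n%:R * K < H (V0 w) by apply: (Dw Initial); rewrite /= inE eqxx.
  have Sw : S n w = s0 by apply: (Dw (Servers n)); rewrite /= !inE eqxx orbT.
  have Aw i : (i < n)%N -> A i w <= K.
    move=> ilt; apply: (Dw (Interarrival i)).
    by rewrite /= !inE map_f ?orbT// mem_iota.
  rewrite /wait_stat Sw -/(H _); have := fixed_wait_drain n w.
  have : \sum_(i < n) A i w <= n%:R * K.
    rewrite mulr_natl -[n in leRHS]card_ord -sumr_const.
    by apply: ler_sum => i _; exact: Aw.
  lra.
apply: (@le_trans _ _ (pr D)); last first.
  apply: pr_le => //; exact/measurable_gt/measurable_wait_stat.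
rewrite PD.
have -> : c * (2 * (2 `^ r / 2)) * (pr (S n @^-1` [set s0]) * p) * excess P X x =
  c * (2 * (2 `^ r / 2) * excess P X x) * (pr (S n @^-1` [set s0]) * p) by ring.
apply: ler_wpM2r; first by rewrite ltW// mulr_gt0.
apply: (@le_trans _ _ (c * excess P X (x + n%:R * K))); last first.
  by apply: Hc; rewrite (le_trans xx0)// lerDl.
rewrite ler_pM2l//; apply: (@le_trans _ _ (excess P X (2 * x))).
  apply: (excess_scale_ge iX) => // y xy; apply: H1; exact: le_trans xy.
by apply: (excess_ni iX); lra.
Qed.

(** One of the peak workload and the size exceeds [x / 2] when the response
    time exceeds [x]. Both tails at [x / 2] are bounded by multiples of
    [G (x / 4)], hence of [G x]; for the size, [G] gains at least [F (x / 2)]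
    between [x / 2] and [x / 4] as soon as [x >= 4]. *)
Lemma response_tail_le (r : R) n : regularly_varying P X r ->
  exists C x0, 0 < C /\ forall x, x0 <= x ->
    tail P (response_time nJ A B S V0 n) x <= C * excess P X x.
Proof.
move=> rvX; have [iX XA] := size_subcritical.
have [C C0 HC] := peak_tail_le rvX.
have q0 : 0 < 4^-1 :> R by rewrite invr_gt0.
have t40 : 0 <= 4^-1 `^ r :> R by rewrite powR_ge0.
have [x1 H1] : exists x1, forall x, x1 <= x ->
    tail P X (4^-1 * x) <= (4^-1 `^ r + 1) * tail P X x.
  by apply: (regvar_le mX rvX) => //; lra.
exists ((C + 1) * (4^-1 * (4^-1 `^ r + 1))), (Num.max x1 4); split.
  by rewrite !mulr_gt0//; lra.
move=> x; rewrite ge_max => /andP[xx1 x4].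
have mXn : measurable_fun setT (size_stat nJ B n).
  by apply: measurable_ordstat => //; exact: measurable_funPT.
have mpk : measurable_fun setT (@peak R N \o V n).
  by apply: measurable_peak; exact: measurable_workload.
have mD1 := measurable_gt mpk (x / 2); have mD2 := measurable_gt mXn (x / 2).
have Xn : tail P (size_stat nJ B n) (x / 2) = tail P X (x / 2).
  congr fine; have mb : measurable [set b : nF.-tuple R | x / 2 < ordstat nJ b].
    by apply: measurable_gt; exact: measurable_ordstat.
  exact: (coc_B_law hm n mb).
apply: (@le_trans _ _ (tail P (@peak R N \o V n) (x / 2) + tail P X (x / 2))).
  rewrite -Xn; apply: le_trans (pr_U_le P mD1 mD2); apply: pr_le.
  - exact/measurable_gt/measurable_response_time.
  - exact: measurableU.
  move=> w /= xR; have := lt_le_trans xR (response_le_peak nJF (V n w) (S n w) (B n w)).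
  rewrite /size_stat; case: (ltP (x / 2) (peak (V n w))) => [|h1]; first by left.
  by move=> h2; right; lra.
rewrite (stationary_tail n (measurable_peak (@measurable_id _ _ setT))).
have G4 : excess P X (4^-1 * x) <= 4^-1 * (4^-1 `^ r + 1) * excess P X x.
  apply: (excess_scale_le iX) => // y xy; apply: H1; exact: le_trans xy.
have t4 : tail P X (x / 2) <= excess P X (4^-1 * x).
  have h : 4^-1 * x <= x / 2 by lra.
  have := excess_diff_ge iX h; have := excess_ge0 P X (x / 2).
  have : 1 * tail P X (x / 2) <= (x / 2 - 4^-1 * x) * tail P X (x / 2).
    by rewrite ler_wpM2r ?tail_ge0//; lra.
  by lra.
have t2 : tail P (@peak R N \o V0) (x / 2) <= C * excess P X (4^-1 * x).
  apply: (le_trans (HC _)); rewrite ler_pM2l//; apply: (excess_ni iX); lra.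
apply: (@le_trans _ _ ((C + 1) * excess P X (4^-1 * x))).
  by rewrite mulrDl mul1r lerD.
rewrite -mulrA ler_pM2l//; lra.
Qed.

Lemma waits_o_regvar (r : R) n (Y : T -> R) :
    regularly_varying P X r -> measurable_fun setT Y ->
    (forall w, wait_stat nJ A B S V0 n w <= Y w <= response_time nJ A B S V0 n w) ->
  O_regularly_varying P Y (1 + r).
Proof.
move=> rvX mY WYR; have [iX XA] := size_subcritical.
have [c [x1 [c0 Hc]]] := wait_tail_ge n rvX.
have [C [x2 [C0 HC]]] := response_tail_le n rvX.
apply: (@o_regvar_sandwich _ _ _ P X Y r c C (Num.max x1 x2)) => // x.
rewrite ge_max => /andP[xx1 xx2]; apply/andP; split.
  apply: (le_trans (Hc _ xx1)); apply: pr_le.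
  - exact/measurable_gt/measurable_wait_stat.
  - exact: measurable_gt.
  - by move=> w /= /lt_le_trans; apply; have /andP[] := WYR w.
apply: le_trans (HC _ xx2); apply: pr_le.
- exact: measurable_gt.
- exact/measurable_gt/measurable_response_time.
- by move=> w /= /lt_le_trans; apply; have /andP[] := WYR w.
Qed.

End Model.

Theorem corollary3 (d : measure_display) (T : measurableType d) (R : realType)
    (P : probability T R) (N nF nJ : nat)
    (hJ : (1 <= nJ)%N) (hJF : (nJ <= nF)%N) (hFN : (nF <= N)%N)
    (A : nat -> {RV P >-> R}) (B : nat -> {RV P >-> nF.-tuple R})
    (S : nat -> T -> {ffun 'I_nF -> 'I_N}) (V0 : {RV P >-> N.-tuple R})
    (hmodel : coc_model A B S V0)
    (hsteady : steady_state nJ A B S V0)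
    (hrho : (rho_U nJ A B < 1)%E)
    (nu : R) (n : nat) :
  (regularly_varying P (size_stat nJ B n) (- nu) ->
     O_regularly_varying P (wait_stat nJ A B S V0 n) (1 - nu)) /\
  (regularly_varying P (size_stat nJ B n) (- nu) ->
     O_regularly_varying P (response_time nJ A B S V0 n) (1 - nu)).
Proof.
have nJF : (1 <= nJ <= nF)%N by rewrite hJ.
have same : regularly_varying P (size_stat nJ B n) (- nu) ->
    regularly_varying P (size_stat nJ B 0) (- nu).
  case=> L sL LE; exists L => // x x0; rewrite -LE//; congr fine.
  have mb : measurable [set b : nF.-tuple R | x < ordstat nJ b].
    by apply: measurable_gt; exact: measurable_ordstat.
  by symmetry; exact: (coc_B_law hmodel n mb).
have WR w : wait_stat nJ A B S V0 n w <= response_time nJ A B S V0 n w.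
  by apply: waits_le_response => // i; exact: (coc_B_ge0 hmodel).
have sandwich := @waits_o_regvar d T R P N nF nJ A B S V0 nJF hFN hmodel hrho hsteady (- nu) n.
split=> /same rvX; apply: sandwich => //.
- exact: measurable_wait_stat.
- by move=> w; rewrite lexx WR.
- exact: measurable_response_time.
- by move=> w; rewrite lexx WR.
Qed.
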